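(* Let $t\in\{\circ+,\ |\circ,\ +\circ\}$. Given a homogeneous regular expression $\mathcal{A}$ of type $\circ+$ of size $m$ and a homogeneous regular expression $\mathcal{B}$ of type $t$ of size $n$, one can decide whether $\mathcal{L}(\mathcal{A})\cap\mathcal{L}(\mathcal{B})\neq\emptyset$ in $\mathcal{O}(m+n)$ time.
   Context: Regular expressions are over an integer alphabet $\Sigma$ of size polynomial in the input size, built with concatenation, union $|$, Kleene plus and Kleene star, and viewed as rooted trees with letters at leaves; the size is the number of leaves. A homogeneous regexp of type $t_1t_2$ has root labelled $t_1$, all depth-1 inner nodes labelled $t_2$, whose children are leaves (children of the root may also be leaves). Thus type $\circ+$ is a concatenation of symbols each of the form $c$ or $c^+$ ($c\in\Sigma$, $c^+$ generating $c^k$ for $k\ge1$); type $|\circ$ is a union $[T_1|\cdots|T_h]$ of nonempty strings; type $+\circ$ is $[T]^+$ for a nonempty string $T$, generating all concatenations of $k\ge1$ copies of $T$. *)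

(* Defs.v *)
From mathcomp Require Import all_boot.

Set Implicit Arguments.
Unset Strict Implicit.
Unset Printing Implicit Defensive.

(** * Regular expressions as rooted trees

    Concatenation and union have arbitrary arity; letters are natural numbers.
    There is no symbol for the empty word or the empty language, which is why
    [wf] forbids concatenation and union nodes without children. *)

Inductive regexp : Type :=
| Letter of nat
| Concat of seq regexp
| Union of seq regexp
| Plus of regexp
| Star of regexp.

Fixpoint wf (r : regexp) : bool :=
  match r with
  | Letter _ => true
  | Concat s | Union s => (0 < size s) && all wf s
  | Plus r' | Star r' => wf r'
  end.

(* The size of a regular expression is its number of leaves. *)
Fixpoint leaves (r : regexp) : nat :=
  match r with
  | Letter _ => 1
  | Concat s | Union s => sumn (map leaves s)
  | Plus r' | Star r' => leaves r'
  end.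

Fixpoint over_alphabet (sigma : nat) (r : regexp) : bool :=
  match r with
  | Letter c => c < sigma
  | Concat s | Union s => all (over_alphabet sigma) s
  | Plus r' | Star r' => over_alphabet sigma r'
  end.

Definition language := seq nat -> Prop.

Definition lang_eps : language := fun u => u = [::].

Definition lang_cat (L M : language) : language :=
  fun u => exists v1 v2, [/\ u = v1 ++ v2, L v1 & M v2].

Definition lang_pow (k : nat) (L : language) : language :=
  iter k (lang_cat L) lang_eps.

Fixpoint lang (r : regexp) : language :=
  match r with
  | Letter c => fun u => u = [:: c]
  | Concat s => foldr (fun r' L => lang_cat (lang r') L) lang_eps s
  | Union s => foldr (fun r' (L : language) u => lang r' u \/ L u)
                     (fun=> False) s
  | Plus r' => fun u => exists2 k, 0 < k & lang_pow k (lang r') u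
  | Star r' => fun u => exists k, lang_pow k (lang r') u
  end.

(** * Homogeneous types *)

Inductive label : Type := LConcat | LUnion | LPlus | LStar.

Definition has_label (l : label) (r : regexp) : bool :=
  match l, r with
  | LConcat, Concat _ | LUnion, Union _ | LPlus, Plus _ | LStar, Star _ => true
  | _, _ => false
  end.

Definition children (r : regexp) : seq regexp :=
  match r with
  | Letter _ => [::]
  | Concat s | Union s => s
  | Plus r' | Star r' => [:: r']
  end.

Definition is_leaf (r : regexp) : bool :=
  if r is Letter _ then true else false.

Definition homogeneous (t : label * label) (r : regexp) : bool :=
  has_label t.1 r &&
  all (fun r' => is_leaf r' || has_label t.2 r' && all is_leaf (children r'))
      (children r).

(** * Word RAM

    A program is a list of instructions over registers [r0, r1, ...] (of which
    it can only mention finitely many) and a random-access memory.  Registers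
    and memory cells hold [w]-bit words, arithmetic is modulo [2 ^ w], and every
    instruction takes one unit of time.  The word size [w] is not known to the
    program. *)

Inductive binop : Type := Add | Sub | Mul | Div.

Inductive instr : Type :=
| IConst (r v : nat)                  (* r := v *)
| IMove (r s : nat)                   (* r := s *)
| IArith (o : binop) (r s t : nat)    (* r := s o t *)
| ILoad (r s : nat)                   (* r := mem[s] *)
| IStore (r s : nat)                  (* mem[r] := s *)
| IJump (l : nat)
| IJumpEq (s t l : nat)               (* if s = t then goto l *)
| IJumpLt (s t l : nat)               (* if s < t then goto l *)
| IAnswer (b : bool).                 (* halt with answer b *)

Definition program := seq instr.

Record state : Type := State {
  pc : nat;
  registers : nat -> nat;
  memory : nat -> nat
}.

Definition eval_binop (w : nat) (o : binop) (x y : nat) : nat :=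
  match o with
  | Add => (x + y) %% 2 ^ w
  | Sub => (x + (2 ^ w - y)) %% 2 ^ w
  | Mul => (x * y) %% 2 ^ w
  | Div => x %/ y
  end.

Definition exec (w : nat) (i : instr) (st : state) : state :=
  let: State p g h := st in
  match i with
  | IConst r v => State p.+1 [eta g with r |-> v %% 2 ^ w] h
  | IMove r s => State p.+1 [eta g with r |-> g s] h
  | IArith o r s t => State p.+1 [eta g with r |-> eval_binop w o (g s) (g t)] h
  | ILoad r s => State p.+1 [eta g with r |-> h (g s)] h
  | IStore r s => State p.+1 g [eta h with g r |-> g s]
  | IJump l => State l g h
  | IJumpEq s t l => State (if g s == g t then l else p.+1) g h
  | IJumpLt s t l => State (if g s < g t then l else p.+1) g h
  | IAnswer _ => st
  end.

(* [run w P T st = Some b] iff [P], started in [st], halts with answer [b] after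
   executing at most [T] instructions.  Leaving the program without reaching an
   [IAnswer] yields no answer. *)
Fixpoint run (w : nat) (P : program) (T : nat) (st : state) : option bool :=
  if T is T'.+1 then
    match onth P (pc st) with
    | Some (IAnswer b) => Some b
    | Some i => run w P T' (exec w i st)
    | None => None
    end
  else None.

(* The input occupies the memory cells 0, 1, 2, ...; everything else is 0. *)
Definition init_state (w : nat) (input : seq nat) : state :=
  State 0 (fun=> 0) (fun a => nth 0 input a %% 2 ^ w).

(* Preorder serialization: the label of each node, followed by the letter at a
   leaf, or by the number of children at a node of variable arity. *)
Fixpoint encode (r : regexp) : seq nat :=
  match r with
  | Letter c => [:: 0; c]
  | Concat s => [:: 1, size s & flatten (map encode s)]
  | Union s => [:: 2, size s & flatten (map encode s)]
  | Plus r' => 3 :: encode r'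
  | Star r' => 4 :: encode r'
  end.

(* Main.v *)
(** [A] is read as a sequence of tokens, one per symbol; a block of adjacent
    tokens with the same letter [c] only matters through its number of symbols
    [l] and of symbols carrying a plus ([c ^ l], or [c ^ k] with [k >= l]).  Two
    such sequences have a common word iff their blocks agree pairwise, and this
    is decided by one streaming pass which absorbs tokens of either side into
    the current block.  A string [T] of a union can be skipped when it is
    shorter than [A], so that matching it costs [O(|T|)].  For [T]^+ the runs of
    [T] are compressed first and are then read cyclically: unless [T] is a power
    of a single letter, between two blocks of [A] at most two runs are read.  If
    [T = a ^ n], only one power of [T] has to be tested. *)

Require Import Defs.
From mathcomp Require Import all_boot zify.

Set Implicit Arguments.
Unset Strict Implicit.
Unset Printing Implicit Defensive.

(** * Structured programs and their compilation *)

(** Blocks can be compared one at a time because a word splits uniquely into maximal runs: once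
    neither side can continue with the current letter, the exponent of its run is settled
    independently of the rest.

    For [T]^+ the number of copies of T is never guessed. If a copy is used up while A still offers
    another letter, a further copy is forced; if both sides end together, a further copy is
    impossible, since it would bring in a letter different from the current one. The last point, and
    termination, need two distinct letters in T: for T = a^n the loop could wrap for ever.

    One measure bounds the steps left. It yields termination and the running time, and it also
    excludes overflow, because each step adds at most a fixed weight to a counter. The largest
    demand comes from exponents of order mn combined with a measure of order m, hence the cubic
    condition on the word size.

    Programs are written and verified as structured commands whose specifications carry a step
    bound; machine code is obtained by compilation. *)

Notation store := (nat -> nat).

Definition upd (f : store) a v : store := fun x => if x == a then v else f x.

Inductive test := TEq of nat & nat | TLt of nat & nat.

Definition holds (b : test) (g : store) :=
  match b with TEq r s => g r == g s | TLt r s => g r < g s end.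

Definition jump (b : test) l :=
  match b with TEq r s => IJumpEq r s l | TLt r s => IJumpLt r s l end.

Inductive cmd :=
| Skip
| Do of instr
| Seq of cmd & cmd
| If of test & cmd & cmd
| Until of test & cmd.

Notation "a ;; b" := (Seq a b) (at level 70, right associativity).

Fixpoint len c :=
  match c with
  | Skip => 0
  | Do _ => 1
  | Seq a b => len a + len b
  | If _ a b => (len a + len b).+2
  | Until _ a => (len a).+2
  end.

(** Jump targets are absolute, so the load address [l] is a parameter. In a conditional the else
    branch comes first and jumps over the other one. *)
Fixpoint code l c : program :=
  match c with
  | Skip => [::]
  | Do i => [:: i]
  | Seq a b => code l a ++ code (l + len a) b
  | If t a b => jump t (l + (len b).+2) :: code l.+1 b ++
                IJump (l + (len a + len b).+2) :: code (l + (len b).+2) a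
  | Until t a => jump t (l + (len a).+2) :: rcons (code l.+1 a) (IJump l)
  end.

Definition target i :=
  match i with
  | IConst r _ | IMove r _ | IArith _ r _ _ | ILoad r _ => [:: r]
  | _ => [::]
  end.

Fixpoint writes c :=
  match c with
  | Skip => [::]
  | Do i => target i
  | Seq a b | If _ a b => writes a ++ writes b
  | Until _ a => writes a
  end.

Fixpoint stores c :=
  match c with
  | Do (IStore _ _) => true
  | Seq a b | If _ a b => stores a || stores b
  | Until _ a => stores a
  | _ => false
  end.

Lemma size_code c l : size (code l c) = len c.
Proof.
elim: c l => //= [a IHa b IHb|b a IHa d IHd|b a IHa] l.
- by rewrite size_cat IHa IHb.
- by rewrite size_cat /= IHa IHd; lia.
- by rewrite size_rcons IHa.
Qed.

(** Total correctness with a step bound. Quantifying over [pre], [post] and the spare fuel [T']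
    allows a verified command to be placed anywhere. The two frame clauses are read off the text of
    the command, so postconditions need not list what it leaves alone. *)
Definition ok w c T (g h : store) (Q : store -> store -> Prop) :=
  exists t g' h', [/\ t <= T, Q g' h', forall r, r \notin writes c -> g' r = g r,
    ~~ stores c -> h' = h
  & forall pre post T',
      let P := pre ++ code (size pre) c ++ post in
      run w P (t + T') (State (size pre) g h) =
      run w P T' (State (size pre + len c) g' h')].

Arguments run : simpl never.

Lemma onth_at (T : Type) (pre post : seq T) x : onth (pre ++ x :: post) (size pre) = Some x.
Proof. by elim: pre. Qed.

Lemma run_step w P T i p g h : onth P p = Some i -> (forall b, i <> IAnswer b) ->
  run w P T.+1 (State p g h) = run w P T (exec w i (State p g h)).
Proof.
by move=> e; rewrite [LHS]/run -/run e; case: i {e} => // b nb; case: (nb b).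
Qed.

Lemma run_jump w P T b l p g h : onth P p = Some (jump b l) ->
  run w P T.+1 (State p g h) = run w P T (State (if holds b g then l else p.+1) g h).
Proof. by move=> e; rewrite (run_step _ _ _ _ e); case: b {e}. Qed.

Lemma ok_weaken w c T T' g h (Q Q' : store -> store -> Prop) :
  ok w c T g h Q -> T <= T' ->
  (forall g' h', (forall r, r \notin writes c -> g' r = g r) ->
     (~~ stores c -> h' = h) -> Q g' h' -> Q' g' h') ->
  ok w c T' g h Q'.
Proof.
move=> [t [g' [h' [le_t q fr fm r]]]] le_T QQ'; exists t, g', h'; split => //.
  exact: leq_trans le_T.
exact: QQ'.
Qed.

Lemma ok_seq w a b T1 T2 g h Q :
  ok w a T1 g h (fun g' h' => ok w b T2 g' h' Q) -> ok w (Seq a b) (T1 + T2) g h Q.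
Proof.
move=> [t [g1 [h1 [le_t [u [g2 [h2 [le_u q fr2 fm2 r2]]]] fr1 fm1 r1]]]].
exists (t + u), g2, h2; split => //; first exact: leq_add.
- by move=> r /=; rewrite mem_cat negb_or => /andP[na nb]; rewrite fr2 ?fr1.
- by rewrite /= negb_or => /andP[na nb]; rewrite fm2 ?fm1.
move=> pre post T' /=; rewrite -addnA -catA r1.
have := r2 (pre ++ code (size pre) a) post T'.
by rewrite /= size_cat size_code -!catA addnA => ->.
Qed.

Lemma ok_if w b a d T1 T2 g h Q :
  (if holds b g then ok w a T1 g h Q else ok w d T2 g h Q) ->
  ok w (If b a d) (maxn T1 T2).+2 g h Q.
Proof.
case: ifP => hb [t [g' [h' [le_t q fr fm r]]]].
  exists t.+1, g', h'; split => //; first by lia.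
  - by move=> x /=; rewrite mem_cat negb_or => /andP[na nb]; rewrite fr.
  - by rewrite /= negb_or => /andP[na nb]; rewrite fm.
  move=> pre post T' /=.
  set j := jump _ _; set c1 := code _ d; set k := IJump _.
  rewrite addSn (@run_jump _ _ _ b (size pre + (len d).+2)) ?onth_at // hb.
  have := r (pre ++ j :: rcons c1 k) post T'.
  rewrite /= size_cat /= size_rcons size_code -!catA /= cat_rcons /= => ->.
  by congr (run _ _ _ (State _ _ _)); lia.
exists t.+2, g', h'; split => //; first by lia.
- by move=> x /=; rewrite mem_cat negb_or => /andP[na nb]; rewrite fr.
- by rewrite /= negb_or => /andP[na nb]; rewrite fm.
move=> pre post T' /=.
set j := jump _ _; set c1 := code _ d; set k := IJump _; set c2 := code _ a.
rewrite addSn (@run_jump _ _ _ b (size pre + (len d).+2)) ?onth_at // hb.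
have := r (pre ++ [:: j]) (k :: c2 ++ post) T'.+1.
rewrite -(catA c1) /= size_cat /= addn1 -!catA /= -/c1 => e; rewrite (addSnnS t T') {}e.
have -> : (size pre).+1 + len d = size (pre ++ j :: c1).
  by rewrite size_cat /= size_code; lia.
have -> : pre ++ j :: c1 ++ k :: c2 ++ post = (pre ++ j :: c1) ++ k :: c2 ++ post.
  by rewrite -catA.
by rewrite [LHS]/run -/run onth_at.
Qed.

(* The credit [phi], counted in machine steps, is also the termination measure. *)
Lemma ok_until w b a (I : nat -> store -> store -> Prop) Q phi g h :
  I phi g h ->
  (forall phi g h, I phi g h -> ~~ holds b g ->
     exists2 T, T.+2 <= phi &
       ok w a T g h (fun g' h' => exists2 phi', T.+2 + phi' <= phi & I phi' g' h')) ->
  (forall phi g h, I phi g h -> holds b g -> Q g h) ->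
  ok w (Until b a) phi.+1 g h Q.
Proof.
move=> Ig step fin; have [N] := ubnP phi.
elim: N phi g h Ig => // N IH phi g h Ig ltN.
have [hb|nhb] := boolP (holds b g).
  exists 1, g, h; split => //; first exact: (fin phi).
  by move=> pre post T' /=; rewrite add1n (@run_jump _ _ _ b (size pre + (len a).+2)) ?onth_at ?hb.
have [T le_T [t [g1 [h1 [le_t [phi' le_phi Ig1] fr1 fm1 r1]]]]] := step _ _ _ Ig nhb.
have [|u [g2 [h2 [le_u q fr2 fm2 r2]]]] := IH phi' g1 h1 Ig1; first by lia.
exists (t.+2 + u), g2, h2; split => //; first by lia.
- by move=> r /= nr; rewrite fr2 ?fr1.
- by move=> /= ns; rewrite fm2 ?fm1.
move=> pre post T' P; rewrite {}/P -(r2 pre post T') /=.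
 set j := jump _ _; set c1 := code _ a; set k := IJump _.
have -> : t.+2 + u + T' = (t + (u + T').+1).+1 by lia.
rewrite (@run_jump _ _ _ b (size pre + (len a).+2)) ?onth_at // (negbTE nhb).
have := r1 (pre ++ [:: j]) (k :: post) (u + T').+1.
rewrite /= size_cat /= addn1 -!catA /= -/c1 cat_rcons => ->.
have -> : (size pre).+1 + len a = size (pre ++ j :: c1).
  by rewrite size_cat /= size_code; lia.
have -> : pre ++ j :: c1 ++ k :: post = (pre ++ j :: c1) ++ k :: post.
  by rewrite -catA.
by rewrite [LHS]/run -/run onth_at.
Qed.

(** Sums and products must not overflow, so that from here on arithmetic is that of natural numbers;
    the word size survives only in these side conditions. *)
Definition wpi w i (Q : store -> store -> Prop) (g h : store) :=
  match i with
  | IConst r v => v < 2 ^ w /\ Q (upd g r v) h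
  | IMove r s => Q (upd g r (g s)) h
  | IArith Add r s t => g s + g t < 2 ^ w /\ Q (upd g r (g s + g t)) h
  | IArith Mul r s t => g s * g t < 2 ^ w /\ Q (upd g r (g s * g t)) h
  | IArith Div r s t => Q (upd g r (g s %/ g t)) h
  | ILoad r s => Q (upd g r (h (g s))) h
  | IStore r s => Q g (upd h (g r) (g s))
  | _ => False
  end.

(** Covers the loop-free code between loops; an [Until] needs an invariant and goes through
    [ok_until]. *)
Fixpoint wp w c (Q : store -> store -> Prop) (g h : store) :=
  match c with
  | Skip => Q g h
  | Do i => wpi w i Q g h
  | Seq a b => wp w a (wp w b Q) g h
  | If t a b => if holds t g then wp w a Q g h else wp w b Q g h
  | Until _ _ => False
  end.

Fixpoint cost c :=
  match c with
  | Skip | Until _ _ => 0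
  | Do _ => 1
  | Seq a b => cost a + cost b
  | If _ a b => (maxn (cost a) (cost b)).+2
  end.

Lemma ok_do w i g h Q : wpi w i Q g h -> ok w (Do i) 1 g h Q.
Proof.
move=> q.
suff [g' [h' [q' fr fm e]]] : exists g' h', [/\ Q g' h',
    forall r, r \notin target i -> g' r = g r, ~~ stores (Do i) -> h' = h
  & forall P T' p, onth P p = Some i ->
      run w P T'.+1 (State p g h) = run w P T' (State p.+1 g' h')].
  exists 1, g', h'; split => // pre post T' /=.
  by rewrite (e _ _ _ (onth_at _ _ _)) addn1.
have fr r v x : x \notin [:: r] -> upd g r v x = g x.
  by rewrite inE /upd => /negbTE ->.
case: i q => //= [r v [lv q]|r s q|[] r s t //= q|r s q|r s q].
- exists (upd g r v), h; split => //; first exact: fr.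
  by move=> P T' p e; rewrite (run_step _ _ _ _ e) //= modn_small.
- by exists (upd g r (g s)), h; split => //; [exact: fr|move=> P T' p e; rewrite (run_step _ _ _ _ e) //].
- case: q => lv q; exists (upd g r (g s + g t)), h; split => //; first exact: fr.
  by move=> P T' p e; rewrite (run_step _ _ _ _ e) //= modn_small.
- case: q => lv q; exists (upd g r (g s * g t)), h; split => //; first exact: fr.
  by move=> P T' p e; rewrite (run_step _ _ _ _ e) //= modn_small.
- by exists (upd g r (g s %/ g t)), h; split => //; [exact: fr|move=> P T' p e; rewrite (run_step _ _ _ _ e) //].
- by exists (upd g r (h (g s))), h; split => //; [exact: fr|move=> P T' p e; rewrite (run_step _ _ _ _ e) //].
- by exists g, (upd h (g r) (g s)); split => // P T' p e; rewrite (run_step _ _ _ _ e).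
Qed.

Lemma wp_ok w c g h Q : wp w c Q g h -> ok w c (cost c) g h Q.
Proof.
elim: c g h Q => //= [g h Q q|i g h Q|a IHa b IHb g h Q q|b a IHa d IHd g h Q].
- by exists 0, g, h; split => // pre post T' /=; rewrite addn0.
- exact: ok_do.
- apply: ok_seq; apply: (ok_weaken (IHa _ _ _ q)) => // g' h' _ _; exact: IHb.
- by move=> q; apply: ok_if; move: q; case: ifP => _; [exact: IHa|exact: IHd].
Qed.

(** * Block matching of token sequences *)

(* [c ^ tw], or any [c ^ k] with [k >= tw] if the number [tf] of pluses is not 0. *)
Record tok := Tok { tc : nat; tw : nat; tf : nat }.

Definition fits t k := (k == tw t) || (0 < tf t) && (tw t <= k).

Fixpoint tokens_lang (s : seq tok) (u : seq nat) : Prop :=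
  if s is t :: s' then
    exists k v, [/\ fits t k, u = nseq k (tc t) ++ v & tokens_lang s' v]
  else u = [::].

Definition positive (s : seq tok) := all (fun t => 0 < tw t) s.

Definition starts c (s : seq tok) := if s is t :: _ then tc t == c else false.

Definition compat l e l' e' :=
  ~~ ((l < l') && (e == 0)) && ~~ ((l' < l) && (e' == 0)).

(** Pluses are counted rather than flagged, so that merging is addition in both components. For the
    converse, the surplus of [k] goes to the first token if it has a plus, and to the second
    otherwise. *)
Lemma tokens_lang_merge c l e l' e' s u :
  tokens_lang (Tok c l e :: Tok c l' e' :: s) u <-> tokens_lang (Tok c (l + l') (e + e') :: s) u.
Proof.
rewrite /= /fits /=; split=> [[k [v [fk -> [k' [v' [fk' -> Tv]]]]]]|[k [v [fk -> Tv]]]].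
  by exists (k + k'), v'; rewrite nseqD catA; split => //; lia.
exists (if 0 < e then k - l' else l), (nseq (if 0 < e then l' else k - l) c ++ v).
rewrite catA -nseqD; split; first by case: ifP; lia.
  by congr (nseq _ _ ++ _); case: ifP; lia.
by exists (if 0 < e then l' else k - l), v; split => //; case: ifP; lia.
Qed.

(** Used to open a block: a token of weight 0 without plus is neutral, whatever its letter. *)
Lemma tokens_lang_tok0 c s u : tokens_lang (Tok c 0 0 :: s) u <-> tokens_lang s u.
Proof.
split=> [[k [v [fk -> Tv]]]|Tu]; last by exists 0, u.
by have -> : k = 0 by move: fk; rewrite /fits /=; lia.
Qed.

Lemma tokens_lang_ohead s c v : positive s -> ~~ starts c s -> tokens_lang s v -> ohead v != Some c.
Proof.
case: s => [_ _ -> //|t s /andP[t_gt0 _]] /= ne [k [v' [fk -> _]]].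
by case: k fk => [|k _ /=]; [rewrite /fits; lia|apply: contraNneq ne => -[->]].
Qed.

Lemma nseq_cat_inj (c : nat) k k' v v' : ohead v != Some c -> ohead v' != Some c ->
  nseq k c ++ v = nseq k' c ++ v' -> k = k' /\ v = v'.
Proof.
move=> nv nv'; elim: k k' => [|k IH] [|k'] //=.
- by move=> e; rewrite e /= eqxx in nv.
- by move=> e; rewrite -e /= eqxx in nv'.
by case=> /IH[-> ->].
Qed.

(** What follows on either side is empty or begins with another letter, so the leading run of [c] in
    a common word is exactly what the two heads produce, with one exponent. If some exponent suits
    both heads, the larger weight does. *)
Lemma tokens_lang_split c l e l' e' s s' :
  positive s -> positive s' -> ~~ starts c s -> ~~ starts c s' ->
  (exists u, tokens_lang (Tok c l e :: s) u /\ tokens_lang (Tok c l' e' :: s') u) <->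
  compat l e l' e' /\ exists u, tokens_lang s u /\ tokens_lang s' u.
Proof.
move=> p p' n n'; split.
  move=> [_ [[k [v [fk -> Tv]]] [k' [v' [fk' eq_u Tv']]]]].
  have [ek ev] := nseq_cat_inj (tokens_lang_ohead p n Tv) (tokens_lang_ohead p' n' Tv') eq_u; subst k' v'.
  by split; [move: fk fk'; rewrite /compat /fits /=; lia|exists v].
move=> [co [v [Tv Tv']]]; exists (nseq (maxn l l') c ++ v).
by split; [exists (maxn l l'), v|exists (maxn l l'), v]; split => //;
  move: co; rewrite /compat /fits /=; lia.
Qed.

Record match_state := St { sc : nat; slx : nat; sfx : nat; sX : seq tok;
                   sly : nat; sfy : nat; sY : seq tok }.

(** At a boundary only the token of A is consumed, and the new block of B starts empty. If B
    continues with another letter, that block stays empty and the mismatch is caught later: by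
    [compat], which meets a positive weight against 0, or as an unread token when A is exhausted. *)
Definition step (R : seq tok) (s : match_state) : match_state + bool :=
  let: St c lx fx X ly fy Y := s in
  match X, Y with
  | [::], [::] => inr (compat lx fx ly fy)
  | [::], y :: Y' => if tc y == c then inl (St c lx fx X (ly + tw y) (fy + tf y) Y')
                     else inr false
  | x :: X', _ =>
    if tc x == c then inl (St c (lx + tw x) (fx + tf x) X' ly fy Y)
    else match Y with
         | [::] => if R is [::] then inr false else inl (St c lx fx X ly fy R)
         | y :: Y' =>
           if tc y == c then inl (St c lx fx X (ly + tw y) (fy + tf y) Y')
           else if compat lx fx ly fy then inl (St (tc x) (tw x) (tf x) X' 0 0 Y)
           else inr false
         end
  end.

Definition joinable (R : seq tok) (s : match_state) : Prop :=
  exists j u, tokens_lang (Tok (sc s) (slx s) (sfx s) :: sX s) u /\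
              tokens_lang (Tok (sc s) (sly s) (sfy s) :: sY s ++ flatten (nseq j R)) u.

Definition letter_neq (t t' : tok) := tc t != tc t'.

(* While [c] is fixed, at most three more steps consume no token of [A]: two
   runs of [T] carrying [c] can only meet at a wrap-around. *)
Definition slack c (Y : seq tok) :=
  if Y is y :: Y' then if tc y == c then if Y' is [::] then 3 else 1 else 0 else 2.

(** With [R] empty, every step that continues consumes exactly one token. Otherwise the size of [sY]
    is useless, since wrapping restores it. Reading a token of A raises the slack by at most 3,
    whence the factor 4. *)
Definition measure (R : seq tok) (s : match_state) :=
  if R is [::] then size (sX s) + size (sY s)
  else 4 * size (sX s) + slack (sc s) (sY s).

Definition isItem t := (tw t == 1) && (tf t <= 1).

(** The last four fields exclude overflow. A token of A adds at most 1 to its counters; a step adds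
    at most [N] to those of B, so [N * measure R s] is the growth still to come. *)
Record loop_inv (R : seq tok) (M N B : nat) (s : match_state) : Prop := LoopInv {
  inv_X : all isItem (sX s);
  inv_Y : positive (sY s);
  inv_R : positive R;
  inv_NY : all (fun t => (tw t <= N) && (tf t <= N)) (sY s);
  inv_NR : all (fun t => (tw t <= N) && (tf t <= N)) R;
  inv_wrap : R = [::] \/ [/\ 1 < size R, sorted letter_neq R & sorted letter_neq (sY s)];
  inv_lx : slx s + size (sX s) <= M;
  inv_fx : sfx s + size (sX s) <= M;
  inv_ly : sly s + N * measure R s <= B;
  inv_fy : sfy s + N * measure R s <= B }.

Lemma slack_le3 c Y : slack c Y <= 3.
Proof. by case: Y => //= y [|y' Y]; case: ifP. Qed.

Lemma step_measure R M N B s s' : loop_inv R M N B s -> step R s = inl s' ->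
  measure R s' < measure R s.
Proof.
case: s => c lx fx X ly fy Y [/= _ _ _ _ _ wrap _ _ _ _].
have absorb y Y' : R = [::] \/ sorted letter_neq (y :: Y') -> tc y == c -> 0 < size R ->
    slack c Y' < slack c (y :: Y').
  move=> so yc nR; have {so} : sorted letter_neq (y :: Y') by case: so nR => [->|].
  rewrite /= yc; case: Y' => //= y' Y' /andP[d _].
  by rewrite /letter_neq (eqP yc) eq_sym in d; rewrite (negbTE d).
have so : R = [::] \/ sorted letter_neq Y by case: wrap => [|[]]; [left|right].
case: X => [|x X] /=.
  case: Y so {wrap} => // y Y so; case: ifP => // yc [<-].
  rewrite /measure; case: R so absorb => [|r R] so absorb /=; first by lia.
  by have := absorb _ _ so yc isT; rewrite /=; lia.
case: ifP => [xc [<-]|xc].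
  by rewrite /measure; case: R {so wrap absorb} => [|r R] /=; lia.
case: Y so wrap => [|y Y] so wrap.
  case: R wrap {so absorb} => // r R [//|[Rgt1 so _]] [<-] /=.
  case: R Rgt1 so => //= r' R _ /andP[d _]; case: (tc r == c) => /=; lia.
case: ifP => [yc [<-]|yc].
  rewrite /measure; case: R so absorb {wrap} => [|r R] so absorb /=; first by lia.
  by have := absorb _ _ so yc isT; rewrite /=; lia.
case: ifP => // _ [<-]; rewrite /measure /=.
case: R {so wrap absorb} => [|r R] /=; first by lia.
by have := slack_le3 (tc x) (y :: Y); rewrite /= yc; lia.
Qed.

Lemma step_inv R M N B s s' : loop_inv R M N B s -> step R s = inl s' -> loop_inv R M N B s'.
Proof.
move=> i e; have := step_measure i e; move: i e.
case: s => c lx fx X ly fy Y [/= iX iY iR NY NR wrap hlx hfx hly hfy].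
(* One unit of the measure pays for one addition of at most [N]. *)
have cr n k k' : k' < k -> n + N * k <= B -> n + N + N * k' <= B.
  move=> lt_k; apply: leq_trans; rewrite -addnA leq_add2l -mulnS.
  by rewrite leq_mul2l lt_k orbT.
have pre y Y' : R = [::] \/ [/\ 1 < size R, sorted letter_neq R & sorted letter_neq (y :: Y')] ->
    R = [::] \/ [/\ 1 < size R, sorted letter_neq R & sorted letter_neq Y'].
  by case=> [->|[? ? /path_sorted ?]]; [left|right].
have absorb y Y' k : k < measure R (St c lx fx X ly fy Y) ->
    all (fun t => (tw t <= N) && (tf t <= N)) (y :: Y') ->
    ly + tw y + N * k <= B /\ fy + tf y + N * k <= B.
  move=> lt_k /andP[/andP[? ?] _].
  by have := cr _ _ _ lt_k hly; have := cr _ _ _ lt_k hfy; lia.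
have small k : k < measure R (St c lx fx X ly fy Y) -> N * k <= B.
  by move=> lt_k; have := cr _ _ _ lt_k hly; lia.
case: X iX hlx hfx hly hfy absorb small => [|x X] iX hlx hfx hly hfy absorb small /=.
  case: Y iY NY wrap hly hfy absorb small => //= y Y /andP[_ iY] NY wrap hly hfy absorb small.
  case: ifP => // yc [<-] lt_m; have [? ?] := absorb _ _ _ lt_m NY.
  by split => //=; [case/andP: NY|exact: pre wrap].
move: iX => /= /andP[/andP[/eqP w1 f1] iX].
case: ifP => [xc [<-] lt_m|xc].
  have le_m n := leq_trans (leq_add (leqnn n) (leq_mul (leqnn N) (ltnW lt_m))).
  by split => //=; rewrite ?w1; rewrite /= in hlx hfx; try lia; apply: le_m.
case: Y iY NY wrap hly hfy absorb small => [|y Y] iY NY wrap hly hfy absorb small.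
  case: R iR NR wrap hly hfy {small absorb pre} => // r R iR NR [//|[? ? _]] hly hfy [<-] lt_m.
  have le_m n := leq_trans (leq_add (leqnn n) (leq_mul (leqnn N) (ltnW lt_m))).
  by split => //; [rewrite /= /isItem iX w1 f1|right|apply: le_m|apply: le_m].
case: ifP => [yc [<-] lt_m|yc].
  have [? ?] := absorb _ _ _ lt_m NY.
  by split => //=; [rewrite /isItem iX w1 f1|case/andP: iY|case/andP: NY|exact: pre wrap].
case: ifP => // _ [<-] lt_m; have ? := small _ lt_m.
by split => //=; rewrite ?w1; rewrite /= in hlx hfx; lia.
Qed.

Lemma positive_cat s1 s2 : positive (s1 ++ s2) = positive s1 && positive s2.
Proof. exact: all_cat. Qed.

Lemma positive_rep j R : positive R -> positive (flatten (nseq j R)).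
Proof. by move=> pR; elim: j => //= j; rewrite positive_cat pR. Qed.

Lemma isItem_positive s : all isItem s -> positive s.
Proof. by apply: sub_all => t /andP[/eqP->]. Qed.

Lemma tokens_lang_mem s u t : positive s -> tokens_lang s u -> List.In t s -> tc t \in u.
Proof.
elim: s u => //= t' s IH u /andP[w_gt0 ps] [k [v [fk -> Tv]]] [<-|/IH].
  by rewrite mem_cat mem_nseq eqxx; move: fk; rewrite /fits; lia.
by move/(_ _ ps Tv); rewrite mem_cat orbC => ->.
Qed.

Lemma step_joinable R M N B s : loop_inv R M N B s ->
  match step R s with
  | inl s' => joinable R s <-> joinable R s'
  | inr b => joinable R s <-> b
  end.
Proof.
case: s => c lx fx X ly fy Y [/= /isItem_positive iX iY iR _ _ wrap _ _ _ _].
have absorbX x X' Y0 : tc x = c ->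
  joinable R (St c lx fx (x :: X') ly fy Y0) <-> joinable R (St c (lx + tw x) (fx + tf x) X' ly fy Y0).
  by case: x => a l e /= ->; split=> -[j [u [/tokens_lang_merge Tx Ty]]]; exists j, u.
have absorbY y X0 Y' : tc y = c ->
  joinable R (St c lx fx X0 ly fy (y :: Y')) <-> joinable R (St c lx fx X0 (ly + tw y) (fy + tf y) Y').
  by case: y => a l e /= ->; split=> -[j [u [Tx /tokens_lang_merge Ty]]]; exists j, u.
have split_spec X0 Y0 : positive X0 -> positive Y0 -> ~~ starts c X0 -> 0 < size Y0 ->
  ~~ starts c Y0 -> joinable R (St c lx fx X0 ly fy Y0) <->
  compat lx fx ly fy /\ exists j u, tokens_lang X0 u /\ tokens_lang (Y0 ++ flatten (nseq j R)) u.
- move=> pX pY nX; case: Y0 pY => // y Y0 pY _ nY; split=> [[j e]|[co [j e]]].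
    move: e; rewrite [sX _]/= [sY _]/=; case/tokens_lang_split => //; first by rewrite positive_cat pY positive_rep.
    by split => //; exists j.
  exists j; apply/tokens_lang_split => //; by rewrite positive_cat pY positive_rep.
case: X iX => [|x X] iX; case: Y iY wrap => [|y Y] iY wrap.
- have base : (exists u, tokens_lang [:: Tok c lx fx] u /\ tokens_lang [:: Tok c ly fy] u) <-> compat lx fx ly fy.
    by rewrite tokens_lang_split //; split=> [[]|co] //; split => //; exists [::].
  split=> [[j [u [Tx Ty]]]|/base[u e]]; last by exists 0, u.
  apply/base; case: wrap => [R0|[Rgt1 so _]].
    exists u; split => //; move: Ty; rewrite R0.
    by have -> : flatten (nseq j ([::] : seq tok)) = [::] by elim: j.
  (* A further copy would contain two adjacent runs with different letters, but the word is a power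
     of [c]. *)
  case: j Ty => [|j] Ty; first by exists u.
  case: Tx => k [w [_ /= ue w0]]; rewrite w0 cats0 in ue.
  case: Ty => k' [v [_ /= ve Tv]].
  have allc a : a \in v -> a = c.
    move=> av; have : a \in u by rewrite ve mem_cat av orbT.
    by rewrite ue mem_nseq => /andP[_ /eqP].
  case: R iR Rgt1 so Tv {absorbX absorbY split_spec base} => [//|r [//|r' R]] iR _ /andP[d _] Tv.
  have pos : positive ((r :: r' :: R) ++ flatten (nseq j (r :: r' :: R))).
    by rewrite positive_cat iR positive_rep.
  have er := allc _ (tokens_lang_mem pos Tv (or_introl erefl)).
  have er' := allc _ (tokens_lang_mem pos Tv (or_intror (or_introl erefl))).
  by rewrite /letter_neq er er' eqxx in d.
- rewrite /=; case: ifP => [/eqP yc|yc]; first exact: absorbY.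
  split=> // /split_spec[] //; first by rewrite /= yc.
  move=> _ [j [u [u0 Ty]]].
  have pos : positive ((y :: Y) ++ flatten (nseq j R)) by rewrite positive_cat iY positive_rep.
  by have := tokens_lang_mem pos Ty (or_introl erefl); rewrite u0.
- rewrite /=; case: ifP => [/eqP xc|xc]; first exact: absorbX.
  (* Without a further copy B only offers powers of [c], while A still has to produce the letter of
     [x]. *)
  have base : ~ exists u, tokens_lang (Tok c lx fx :: x :: X) u /\ tokens_lang (Tok c ly fy :: [::]) u.
    move=> [u [Tx [k [w [_ /= ue w0]]]]]; rewrite {}ue {}w0 cats0 in Tx.
    have := tokens_lang_ohead iX _ _; have := iX.
    case: Tx => k' [v [_ ev Tv]] _ /(_ c v); rewrite /= xc => /(_ isT Tv).
    case: v ev Tv => [_ [k2 [v [fk2]]]|a v ev _ /=].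
      by case: k2 fk2 => //; case/andP: iX => wx _; rewrite /fits; lia.
    have : a \in nseq k c by rewrite ev mem_cat in_cons eqxx orbT.
    by rewrite mem_nseq => /andP[_ /eqP->]; rewrite eqxx.
  case: R iR wrap absorbX absorbY split_spec => [|r R] iR wrap absorbX absorbY split_spec.
    split=> // -[j [u]]; have -> : flatten (nseq j ([::] : seq tok)) = [::] by elim: j.
    by move=> e; case: base; exists u.
  split=> [[[|j] [u e]]|[j [u e]]]; first by case: base; exists u.
    by exists j, u.
  by exists j.+1, u.
- rewrite /=; case: ifP => [/eqP xc|xc]; first exact: absorbX.
  case: ifP => [/eqP yc|yc]; first exact: absorbY.
  have := split_spec (x :: X) (y :: Y) iX iY.
  rewrite /= xc yc => /(_ isT isT isT) sp.
  case: ifP => co; last by split=> // /sp[]; rewrite co.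
  apply: (iff_trans sp); split=> [[_ [j [u [Tx Ty]]]]|[j [u [Tx Ty]]]].
    by exists j, u; split; [case: (x) Tx|apply/tokens_lang_tok0].
  split => //; exists j, u; split; first by case: (x) Tx.
  by move/tokens_lang_tok0: Ty.
Qed.

(** * Block matching on the word RAM *)

Fixpoint repItems (h : store) p s e : Prop :=
  if s is t :: s' then
    [/\ isItem t, h p = 3 * tf t, h (p + tf t).+1 = tc t
      & repItems h (p + tf t).+2 s' e]
  else p = e.

Fixpoint repRuns (h : store) p s e : Prop :=
  if s is t :: s' then
    [/\ tf t = 0, h p = tc t, h p.+1 = tw t & repRuns h p.+2 s' e]
  else p = e.

Lemma repItems_size h p s e : repItems h p s e -> p + 2 * size s <= e.
Proof.
by elim: s p => [|t s IH] p /=; [move=> ->; lia|case=> _ _ _ /IH; lia].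
Qed.

Lemma repRuns_size h p s e : repRuns h p s e -> p + 2 * size s = e.
Proof.
by elim: s p => [|t s IH] p /=; [move=> ->; lia|case=> _ _ _ /IH; lia].
Qed.

(* Registers:  0-3 the constants 0, 1, 2, 3;  4, 5 current position in [A] and
   its end;  6-8 letter, pluses and successor of the token read there;
   9-11 current position in [B], end, and start for wrapping around (equal to the
   end if there is no wrapping);  12-15 letter, pluses, successor and weight of
   the token read there;  16 letter of the current block;  17, 18 weight and
   pluses of the block of [A], 19, 20 of that of [B];  21 still running;
   22 result;  23 scanning position;  24, 25 start and length of a string;
   26, 30 temporary;  27 size of [A];  28, 31, 29 number of strings of a union,
   strings done and answer so far;  31, 32 reading and writing position, 33, 34
   letter and length of the current run during compression. *)

(* The label of a leaf is 0 and that of a plus node is 3, so that a third of the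
   label is the number of pluses and also the offset of the leaf. *)
Definition parseItem p c f n :=
  Do (ILoad f p) ;; Do (IArith Div f f 3) ;;
  Do (IArith Add n p f) ;; Do (IArith Add n n 1) ;;
  Do (ILoad c n) ;; Do (IArith Add n n 1).

Definition parseRun :=
  Do (ILoad 12 9) ;; Do (IMove 13 0) ;;
  Do (IArith Add 14 9 1) ;; Do (ILoad 15 14) ;; Do (IArith Add 14 14 1).

Definition rejectC := Do (IMove 22 0) ;; Do (IMove 21 0).

Definition compatC :=
  Do (IConst 22 1) ;;
  If (TLt 17 19) (If (TEq 18 0) (Do (IMove 22 0)) Skip) Skip ;;
  If (TLt 19 17) (If (TEq 20 0) (Do (IMove 22 0)) Skip) Skip.

Definition absorbX :=
  Do (IArith Add 17 17 1) ;; Do (IArith Add 18 18 7) ;; Do (IMove 4 8).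

Definition absorbY :=
  Do (IArith Add 19 19 15) ;; Do (IArith Add 20 20 13) ;; Do (IMove 9 14).

Definition boundaryC :=
  Do (IMove 16 6) ;; Do (IMove 17 1) ;; Do (IMove 18 7) ;;
  Do (IMove 4 8) ;; Do (IMove 19 0) ;; Do (IMove 20 0).

Definition matchBody parseY :=
  If (TEq 4 5)
    (If (TEq 9 10)
      (compatC ;; Do (IMove 21 0))
      (parseY ;; If (TEq 12 16) absorbY rejectC))
    (parseItem 4 6 7 8 ;;
     If (TEq 6 16) absorbX
      (If (TEq 9 10)
        (If (TEq 11 10) rejectC (Do (IMove 9 11)))
        (parseY ;;
         If (TEq 12 16) absorbY
          (compatC ;; If (TEq 22 0) (Do (IMove 21 0)) boundaryC)))).

Record consts w (g : store) : Prop := Consts {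
  const0 : g 0 = 0; const1 : g 1 = 1; const2 : g 2 = 2; const3 : g 3 = 3; constw : 4 < 2 ^ w }.

(** All that the matching loop asks of a memory format for B. Encoded symbols and compressed runs
    both satisfy it, so the loop is verified once. *)
Definition Yformat w (rep : store -> nat -> seq tok -> nat -> Prop) parse :=
  (forall h p s e, rep h p s e -> (p == e) = nilp s) /\
  (forall (g h : store) t Y Q, consts w g -> rep h (g 9) (t :: Y) (g 10) -> g 10 < 2 ^ w ->
   (forall g' n, rep h n Y (g 10) ->
     g' =1 upd (upd (upd (upd g 12 (tc t)) 13 (tf t)) 14 n) 15 (tw t) -> Q g' h) ->
   wp w parse Q g h).


Lemma wp_parseItem w p c f n (g h : store) t s e Q :
  consts w g -> uniq [:: 0; 1; 3; p; c; f; n] -> repItems h (g p) (t :: s) e -> e < 2 ^ w ->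
  (forall g' m, repItems h m s e ->
    g' =1 upd (upd (upd g c (tc t)) f (tf t)) n m -> Q g' h) ->
  wp w (parseItem p c f n) Q g h.
Proof.
move=> [c0 c1 _ c3 cw] un [/andP[_ f1] h1 h2 rs] le_e q.
have le_s := repItems_size rs.
(* Distinct positions in the duplicate-free list give distinct registers. *)
have d i j : i != j -> i < 7 -> j < 7 ->
    (nth 0 [:: 0; 1; 3; p; c; f; n] i == nth 0 [:: 0; 1; 3; p; c; f; n] j) = false.
  by move=> *; rewrite nth_uniq //; apply: negbTE.
have e3 : 3 * tf t %/ 3 = tf t by rewrite mulKn.
have e1 := d 1 6 isT isT isT; have e2 := d 2 5 isT isT isT; have e4 := d 3 5 isT isT isT.
have e5 := d 1 5 isT isT isT; have e6 := d 1 4 isT isT isT; have e7 := d 6 4 isT isT isT.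
rewrite /= in e1 e2 e4 e5 e6 e7.
rewrite /= /upd !eqxx e1 e2 e4 e5 e6 e7 c1 c3 h1 e3 addn1 h2; split; first by lia.
split; first by lia.
rewrite addn1; split; first by lia.
apply: (q _ _ rs) => x /=.
have e8 := d 4 5 isT isT isT; have e9 := d 4 6 isT isT isT; have e10 := d 5 6 isT isT isT.
rewrite /= in e8 e9 e10; rewrite /upd.
case: (x == n) => //; case: (x =P c) => [->|_]; first by rewrite e8.
by case: (x == f).
Qed.

Lemma Yformat_items w : Yformat w repItems (Seq (parseItem 9 12 13 14) (Do (IMove 15 1))).
Proof.
split=> [h p s e rs|g h t Y Q cs ry le_e q].
  have := repItems_size rs; case: s rs => [->|t s _] /=; first by rewrite eqxx.
  by move=> ?; apply/negbTE; lia.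
apply: (wp_parseItem cs _ ry) => // g' m rs e; rewrite /=.
apply: (q _ _ rs) => x; rewrite /upd e /upd e /= (const1 cs).
by have [/andP[/eqP-> _] _ _ _] := ry.
Qed.

Lemma Yformat_runs w : Yformat w repRuns parseRun.
Proof.
split=> [h p s e rs|g h t Y Q [c0 c1 _ c3 cw] [tf0 hc hw ry] le_e q].
  have := repRuns_size rs; case: s rs => [->|t s _] /=; first by rewrite eqxx.
  by move=> ?; apply/negbTE; lia.
have := repRuns_size ry => le_s.
rewrite /= /upd /= c1; split; first by lia.
split; first by lia.
rewrite !addn1; apply: (q _ _ ry) => x /=; rewrite /upd hc hw c0 tf0.
by case: (x =P 14) => [->|_] //; case: (x =P 15) => [->|_] //; case: (x =P 13).
Qed.

Lemma wp_compatC w (g h : store) Q : consts w g ->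
  (forall g', g' =1 upd g 22 (compat (g 17) (g 18) (g 19) (g 20)) -> Q g' h) ->
  wp w compatC Q g h.
Proof.
move=> [c0 c1 _ _ cw] q; rewrite /= /upd /= c0; split; first by lia.
have q' b : compat (g 17) (g 18) (g 19) (g 20) = b ->
    forall g', g' =1 upd g 22 b -> Q g' h by move=> <-.
rewrite /compat in q'; case: ltngtP q' => _ q' /=; rewrite ?c0.
- case: (g 18 == 0) q' => q'; apply: (q' _ erefl) => x; rewrite /upd /=;
    by case: (x == 22).
- case: (g 20 == 0) q' => q'; apply: (q' _ erefl) => x; rewrite /upd /=;
    by case: (x == 22).
- exact: (q' _ erefl).
Qed.

Record mrel w rep (R : seq tok) (s : match_state) (g h : store) : Prop := Mrel {
  rel_consts : consts w g;
  rel_X : repItems h (g 4) (sX s) (g 5);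
  rel_Y : rep h (g 9) (sY s) (g 10);
  rel_R : rep h (g 11) R (g 10);
  rel_c : g 16 = sc s;
  rel_lx : g 17 = slx s;
  rel_fx : g 18 = sfx s;
  rel_ly : g 19 = sly s;
  rel_fy : g 20 = sfy s;
  rel_boundX : g 5 < 2 ^ w;
  rel_boundY : g 10 < 2 ^ w }.

Lemma wp_if_true w b a d Q (g h : store) :
  holds b g -> wp w a Q g h -> wp w (If b a d) Q g h.
Proof. by move=> /= ->. Qed.

Lemma wp_if_false w b a d Q (g h : store) :
  ~~ holds b g -> wp w d Q g h -> wp w (If b a d) Q g h.
Proof. by move=> /= /negbTE->. Qed.

Lemma wp_seq w a b Q g h : wp w (Seq a b) Q g h = wp w a (wp w b Q) g h.
Proof. by []. Qed.

Definition bounded w s := [&& slx s < 2 ^ w, sfx s < 2 ^ w, sly s < 2 ^ w & sfy s < 2 ^ w].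

Ltac leaf e :=
  split; [split; [split|..]|]; rewrite /= ?/upd /= ?e ?/upd //=.

Lemma wp_matchBody w rep parse R s (g h : store) :
  Yformat w rep parse -> mrel w rep R s g h ->
  (forall s', step R s = inl s' -> bounded w s') ->
  wp w (matchBody parse) (fun g' h' =>
    match step R s with
    | inl s' => mrel w rep R s' g' h' /\ g' 21 = g 21
    | inr b => [/\ g' 0 = 0, g' 21 = 0 & g' 22 = b]
    end) g h.
Proof.
move=> [rep_nil wp_parse] rel; case: (rel).
case: s rel => c lx fx X ly fy Y rel [c0 c1 c2 c3 cw] rX rY rR rc rlx rfx rly rfy bX bY bd.
have cs := rel_consts rel; rewrite /= in rX rY rc rlx rfx rly rfy.
have rXnil : (g 4 == g 5) = nilp X.
  by move: (repItems_size rX); case: X {rel bd} rX => [->|x X] /=; rewrite ?eqxx // => *; apply/negbTE; lia.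
have rYnil := rep_nil _ _ _ _ rY; have rRnil := rep_nil _ _ _ _ rR.
rewrite /matchBody; case: X rel rX rXnil bd => [|x X] rel rX rXnil bd.
  apply: wp_if_true; first by rewrite /= rXnil.
  case: Y rel rY rYnil bd => [|y Y] rel rY rYnil bd.
    apply: wp_if_true; first by rewrite /= rYnil.
    rewrite wp_seq; apply: wp_compatC => // g' e.
    by rewrite /= /upd !e /upd /= rlx rfx rly rfy.
  apply: wp_if_false; first by rewrite /= rYnil.
  rewrite wp_seq; set k := wp w (If _ _ _) _.
  apply: (wp_parse _ _ _ _ _ _ rY) => // g' n rY' e.
  rewrite {}/k /= !e /upd /= rc; move: bd; rewrite /=; case: ifP => [/eqP yc bd|yc bd].
    have /and4P[/= _ _ bly bfy] := bd _ erefl.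
    by rewrite !e /upd /= rly rfy; do 2![split => //]; leaf e.
  by rewrite !e /upd /= c0.
apply: wp_if_false; first by rewrite /= rXnil.
rewrite wp_seq; set k := wp w (If _ _ _) _.
apply: (wp_parseItem (s := X) _ _ rX) => // g' m rX' e.
rewrite {}/k; have [/andP[/eqP xw xf] _ _ _] := rX.
have [xc|xc] := boolP (tc x == c).
  apply: wp_if_true; first by rewrite /= !e /upd /= rc.
  move: bd; rewrite /= /upd /= !e /upd /= xc => /(_ _ erefl) /and4P[/= blx bfx _ _].
  by rewrite xw in blx *; rewrite c1 rlx rfx; do 2![split => //]; leaf e.
apply: wp_if_false; first by rewrite /= !e /upd /= rc.
rewrite /= (negbTE xc) in bd.
case: Y rel rY rYnil bd => [|y Y] rel rY rYnil bd.
  apply: wp_if_true; first by rewrite /= !e /upd /= rYnil.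
  move: rR rRnil bd rel; case: R => [|r R] rR rRnil bd rel.
    apply: wp_if_true; first by rewrite /= !e /upd /= rRnil.
    by rewrite /= /upd /= !e /upd /= c0 (negbTE xc).
  apply: wp_if_false; first by rewrite /= !e /upd /= rRnil.
  by rewrite /= (negbTE xc); leaf e.
apply: wp_if_false; first by rewrite /= !e /upd /= rYnil.
rewrite wp_seq; set k := wp w (If _ _ _) _.
have cs' : consts w g' by split; rewrite ?e.
apply: (wp_parse g' _ y Y _ cs'); rewrite ?e // => g1 n rY1 e1.
rewrite {}/k; have [yc|yc] := boolP (tc y == c).
  apply: wp_if_true; first by rewrite /= !e1 /upd /= e /upd /= rc.
  move: bd; rewrite yc => /(_ _ erefl) /and4P[/= _ _ bly bfy].
  rewrite /= (negbTE xc) yc /upd /= !e1 /upd /= !e /upd /= rly rfy; do 2![split => //].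
  by leaf e1; rewrite ?e /upd //=.
apply: wp_if_false; first by rewrite /= !e1 /upd /= e /upd /= rc.
rewrite wp_seq; set k := wp w (If _ _ _) _.
apply: wp_compatC => [|g2 e2]; first by split; rewrite ?e1 /upd /= ?e.
have {}e2 r : g2 r = if r == 22 then (compat lx fx ly fy : nat) else g1 r.
  by rewrite e2 /upd !e1 /upd /= !e /upd /= rlx rfx rly rfy.
rewrite {}/k /= (negbTE xc) (negbTE yc); case: (compat _ _ _ _) e2 => e2.
  rewrite /upd /= !e2 /= !e1 /upd /= !e /upd /= c0 c1 /=.
  by leaf e2; rewrite ?e1 /upd /= ?e /upd //=.
by rewrite /upd /= !e2 /= !e1 /upd /= !e /upd /= c0.
Qed.

Definition matchLoop parse := Until (TEq 21 0) (matchBody parse).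

(** A round costs the body, the test and the jump back. There are [k.+1] rounds because the deciding
    step need not lower the measure; the last unit is the exit test. *)
Definition matchCost parse k := (((cost (matchBody parse)).+2) * k.+1).+1.

Lemma ok_matchLoop w rep parse R M N B s (g h : store) :
  Yformat w rep parse -> mrel w rep R s g h -> loop_inv R M N B s -> g 21 = 1 ->
  M < 2 ^ w -> B < 2 ^ w ->
  ok w (matchLoop parse) (matchCost parse (measure R s)) g h (fun g' h' =>
    exists2 b : bool, g' 22 = b & (joinable R s <-> b)).
Proof.
move=> yf rel iv run1 ltM ltB; set K := (cost (matchBody parse)).+2.
(* Either the search goes on, with credit for every remaining round, or the result is in register 22
   and only the exit test is left. *)
apply: (@ok_until _ _ _ (fun phi g' h' =>
  (exists s', [/\ mrel w rep R s' g' h', loop_inv R M N B s', g' 21 = 1,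
     joinable R s <-> joinable R s' & K * (measure R s').+1 <= phi]) \/
  [/\ g' 0 = 0, g' 21 = 0 & exists2 b : bool, g' 22 = b & (joinable R s <-> b)])).
- by left; exists s.
- move=> phi g1 h1 [[s1 [rel1 iv1 run_1 sp1 le_phi]]|[z r0 _]]; last by rewrite /= r0 z.
  move=> _; exists (cost (matchBody parse)); first by move: le_phi; rewrite /K; lia.
  have bd s' : step R s1 = inl s' -> bounded w s'.
    move=> e; have [_ _ _ _ _ _ ? ? ? ?] := step_inv iv1 e.
    by apply/and4P; split; lia.
  apply: (ok_weaken (wp_ok (wp_matchBody yf rel1 bd))) => // g2 h2 _ _ /=.
  have := step_joinable iv1; have := @step_inv _ _ _ _ _ ^~ iv1; have := @step_measure _ _ _ _ _ ^~ iv1.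
  case: (step R s1) => [s2 /(_ _ erefl) lt_m /(_ _ erefl) iv2 sp2 [rel2 run2]|b _ _ sp2 [z r0 res]].
    exists (K * (measure R s2).+1).
      by rewrite -/K; apply: leq_trans le_phi; rewrite -mulnS leq_mul2l ltnS lt_m orbT.
    by left; exists s2; split => //; [rewrite run2|apply: iff_trans sp2].
  exists 0; first by rewrite addn0 -/K; apply: leq_trans le_phi; rewrite leq_pmulr.
  by right; split => //; exists b => //; apply: iff_trans sp2.
- move=> phi g1 h1 [[s1 [rel1 _ run_1 _ _]]|[_ _ r] _ //].
  by rewrite /= run_1 (const0 (rel_consts rel1)).
Qed.

(** * Homogeneous expressions as token sequences *)

Definition flat r := is_leaf r || has_label LPlus r && all is_leaf (children r).

(** The default is a legitimate symbol, so that [isItem_tok_of] and [all_tok_le] need no hypothesis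
    on the shape. *)
Definition tok_of r :=
  match r with
  | Letter c => Tok c 1 0
  | Plus (Letter c) => Tok c 1 1
  | _ => Tok 0 1 0
  end.

Variant flat_spec : regexp -> Prop :=
| FlatLetter c : flat_spec (Letter c)
| FlatPlus c : flat_spec (Plus (Letter c)).

Lemma flatP r : flat r -> flat_spec r.
Proof.
by case: r => //= [c _|]; [constructor|case=> //= c _; constructor].
Qed.

Lemma lang_pow_word k (L : language) T u : (forall v, L v <-> v = T) ->
  lang_pow k L u <-> u = flatten (nseq k T).
Proof.
move=> LT; elim: k u => [|k IH] u //=; split.
  by move=> [v1 [v2 [-> /LT-> /IH->]]].
by move=> ->; exists T, (flatten (nseq k T)); split => //; [apply/LT|apply/IH].
Qed.

Lemma lang_tok r u : flat r -> lang r u <-> exists2 k, fits (tok_of r) k & u = nseq k (tc (tok_of r)).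
Proof.
case/flatP=> c /=; rewrite /fits /=.
  by split=> [->|[k /orP[/eqP->|] //]]; exists 1.
have pw k : lang_pow k (fun u => u = [:: c]) u <-> u = nseq k c.
  apply: (iff_trans (lang_pow_word k u (T := [:: c]) _)) => //.
  by have -> : flatten (nseq k [:: c]) = nseq k c by elim: k => //= k ->.
by split=> [[k k_gt0 /pw]|[k k_gt0 /pw]] uk; exists k => //; lia.
Qed.

Lemma lang_items s u : all flat s -> lang (Concat s) u <-> tokens_lang (map tok_of s) u.
Proof.
elim: s u => // r s IH u /andP[fr fs] /=; split.
  move=> [v1 [v2 [-> /lang_tok -/(_ fr)[k fk ->] l2]]].
  by exists k, v2; split => //; apply/IH.
move=> [k [v [fk -> Tv]]]; exists (nseq k (tc (tok_of r))), v; split => //.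
  by apply/lang_tok => //; exists k.
exact/IH.
Qed.

(** * Memory segments holding encoded expressions *)

Fixpoint seg (h : store) p (l : seq nat) : Prop :=
  if l is x :: l' then h p = x /\ seg h p.+1 l' else True.

Lemma seg_cat h p l1 l2 : seg h p (l1 ++ l2) <-> seg h p l1 /\ seg h (p + size l1) l2.
Proof.
elim: l1 p => [|x l1 IH] p /=; first by rewrite addn0; split=> // -[].
by rewrite IH addnS addSn; tauto.
Qed.

Lemma seg_nth h p l : (forall i, i < size l -> h (p + i) = nth 0 l i) -> seg h p l.
Proof.
elim: l p => //= x l IH p hl; split; first by have := hl 0 isT; rewrite addn0.
by apply: IH => i lt_i; have := hl i.+1 lt_i; rewrite addnS addSn.
Qed.

Definition encodes s := flatten (map encode s).

Lemma seg_items h p s : all flat s -> seg h p (encodes s) ->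
  repItems h p (map tok_of s) (p + size (encodes s)).
Proof.
elim: s p => [|r s IH] p /=; first by rewrite addn0.
move=> /andP[fr fs]; rewrite /encodes /= -/(encodes s) => /seg_cat[hr /IH-/(_ fs) rs].
rewrite size_cat addnA; case/flatP: fr hr rs => c /= [-> hc] rs.
  by case: hc => hc _; rewrite addn2 in rs; rewrite !addn0 addn2.
by case: hc => _ [hc _]; rewrite addn3 in rs; rewrite !addn1 addn3.
Qed.

Lemma size_encodes_flat s : all flat s -> size (encodes s) <= 3 * size s.
Proof.
elim: s => // r s IH /andP[fr /IH]; rewrite /encodes /= -/(encodes s) size_cat.
by case/flatP: fr => c /=; lia.
Qed.

Lemma leaves_flat s : all flat s -> sumn (map leaves s) = size s.
Proof. by elim: s => //= r s IH /andP[fr /IH->]; case/flatP: fr. Qed.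

Lemma encodes_bounded sigma W s : all flat s -> all (over_alphabet sigma) s ->
  sigma <= W -> 3 < W -> all (fun x => x < W) (encodes s).
Proof.
move=> fs os leW W3; elim: s fs os => // r s IH /andP[fr fs] /andP[o /(IH fs) bs].
rewrite /encodes /= -/(encodes s) all_cat bs andbT.
by case/flatP: fr o => c /= lt_c; rewrite ?andbT; apply/and3P || apply/andP; split; lia.
Qed.

Lemma isItem_tok_of s : all isItem (map tok_of s).
Proof. by elim: s => //= r s ->; case: r => // -[]. Qed.

Definition kids r := if r is Concat s then s else [:: r].

Definition stringy r := is_leaf r || has_label LConcat r && all is_leaf (children r).

Lemma leaf_flat s : all is_leaf s -> all flat s.
Proof. by apply: sub_all => r lr; rewrite /flat lr. Qed.

Lemma stringy_kids r : stringy r -> all is_leaf (kids r).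
Proof. by case: r => //= s; rewrite orbF. Qed.

Lemma lang_kids r u : stringy r -> lang r u <-> tokens_lang (map tok_of (kids r)) u.
Proof.
case: r => //= [c _|s sl].
  split=> [->|[k [v [fk -> ->]]]]; first by exists 1, [::].
  by move: fk; rewrite /fits /= orbF => /eqP->.
exact: (lang_items u (leaf_flat sl)).
Qed.

Definition letters s := map (tc \o tok_of) s.

Lemma tok_of_leaf s : all is_leaf s -> map tok_of s = [seq Tok c 1 0 | c <- letters s].
Proof. by elim: s => //= r s IH /andP[lr /IH->]; case: r lr. Qed.

(** * Run-length encoding and powers of a single letter *)

Lemma tokens_lang_exact s u : all (fun t => tf t == 0) s ->
  tokens_lang s u <-> u = flatten [seq nseq (tw t) (tc t) | t <- s].
Proof.
elim: s u => // t s IH u /andP[/eqP t0 /IH{}IH] /=; split.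
  by move=> [k [v [+ -> /IH->]]]; rewrite /fits t0 orbF => /eqP->.
by move=> ->; exists (tw t); eexists; split; [rewrite /fits eqxx|reflexivity|apply/IH].
Qed.

Lemma tokens_lang_letters T u : tokens_lang [seq Tok c 1 0 | c <- T] u <-> u = T.
Proof.
rewrite tokens_lang_exact; last by rewrite all_map; apply/allP.
by rewrite -map_comp (_ : flatten _ = T) //; elim: T => //= c T ->.
Qed.

(** [a] and [n] are the letter and length of the run still open. They correspond to two registers of
    the compression loop, whose invariant is an equation between values of [runs]. *)
Fixpoint runs a n T :=
  if T is c :: T' then
    if c == a then runs a n.+1 T' else Tok a n 0 :: runs c 1 T'
  else [:: Tok a n 0].

Lemma runs_exact a n T : all (fun t => tf t == 0) (runs a n T).
Proof. by elim: T a n => //= c T IH a n; case: ifP => //= _; rewrite IH. Qed.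

Lemma runs_word a n T :
  flatten [seq nseq (tw t) (tc t) | t <- runs a n T] = nseq n a ++ T.
Proof.
elim: T a n => [|c T IH] a n //=; case: (c =P a) => [->|_] /=; last by rewrite IH.
by rewrite IH -cat_rcons; congr (_ ++ _); elim: n => //= n ->.
Qed.

Lemma tokens_lang_runs_rep a n T k u :
  tokens_lang (flatten (nseq k (runs a n T))) u <-> u = flatten (nseq k (nseq n a ++ T)).
Proof.
rewrite tokens_lang_exact; last by elim: k => //= k IH; rewrite all_cat runs_exact.
by rewrite (_ : flatten (map _ _) = flatten (nseq k (nseq n a ++ T))) //;
   elim: k => //= k IH; rewrite map_cat flatten_cat IH runs_word.
Qed.

Lemma runs_positive a n T : 0 < n -> positive (runs a n T).
Proof. by elim: T a n => [|c T IH] a n n_gt0 /=; rewrite ?n_gt0 //; case: ifP => _ /=; rewrite ?n_gt0 IH. Qed.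

Lemma runs_head a n T : exists m s, runs a n T = Tok a m 0 :: s.
Proof. by elim: T n => [|c T IH] n /=; [|case: ifP => _]; try apply: IH; do 2 eexists. Qed.

Lemma runs_sorted a n T : sorted letter_neq (runs a n T).
Proof.
elim: T a n => //= c T IH a n; case: ifP => ca; first exact: IH.
have [m [s e]] := runs_head c 1 T; have := IH c 1.
by rewrite e /= => ->; rewrite /letter_neq /= eq_sym ca.
Qed.

Lemma runs_weight a n T N : 0 < N -> n + size T <= N ->
  all (fun t => (tw t <= N) && (tf t <= N)) (runs a n T).
Proof.
move=> N_gt0; elim: T a n => /= [|c T IH] a n; first by rewrite addn0 => ->.
by move=> leN; case: ifP => _ /=; rewrite ?IH; try lia.
Qed.

Lemma runs_unary a n T : size (runs a n T) = 1 ->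
  T = nseq (size T) a /\ runs a n T = [:: Tok a (n + size T) 0].
Proof.
elim: T n => [|c T IH] n /=; first by rewrite addn0.
case: (c =P a) => [-> /IH[eT ->]|_]; first by rewrite -eT addSnnS.
by have [m [s ->]] := runs_head c 1 T.
Qed.

(** If [K] exceeds the number of symbols, some plus repeats its letter, and this plus can absorb any
    surplus while the other symbols are taken once. In the induction, either the first symbol is
    taken once and the surplus lies in the rest, or its own plus is the one to use. *)
Lemma tokens_lang_nseq X a K : all isItem X -> tokens_lang X (nseq K a) ->
  size X <= K /\ (K = size X \/ forall K', size X <= K' -> tokens_lang X (nseq K' a)).
Proof.
elim: X K => [|[c l e] X IH] K /=; first by case: K => // _ _; split => //; left.
move=> /andP[/andP[/= /eqP-> e1] iX] [k [v [fk eqK Tv]]].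
have [a_k v_eq lt_k] : [/\ 0 < k -> c = a, v = nseq (size v) a & K = k + size v].
  have all_a x : x \in nseq k c ++ v -> x = a by rewrite -eqK mem_nseq => /andP[_ /eqP].
  split; [|apply/all_pred1P/allP => x xv|by have := congr1 size eqK; rewrite size_nseq size_cat size_nseq].
    by move=> k_gt0; apply: all_a; rewrite mem_cat mem_nseq k_gt0 eqxx.
  by rewrite /= (all_a x) // mem_cat xv orbT.
have k_gt0 : 0 < k by move: fk; rewrite /fits /=; lia.
have ca := a_k k_gt0; rewrite v_eq in Tv; have [le_X alt] := IH _ iX Tv.
split; first by lia.
have [->|eX] := eqVneq K (size X).+1; [by left|right=> K' le_K'].
have [k1|k_ne1] := eqVneq k 1.
  exists 1, (nseq (K' - 1) a); rewrite ca -nseqD subnKC; last by lia.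
  by split => //; case: alt => [vX|]; [lia|apply; lia].
exists (K' - size X), (nseq (size X) a); rewrite ca -nseqD subnK; last by lia.
by split => //; [move: fk; rewrite /fits /=; lia|case: alt => [<- //|]; apply].
Qed.

(** If [n] divides [size X], that exponent decides, since pumping reaches it too. If not, it cannot
    occur, and any larger multiple of [n] decides; [size X * n] is one that needs no rounding. *)
Lemma tokens_lang_nseq_multiple X a n : all isItem X -> 0 < size X -> 0 < n ->
  (exists k, tokens_lang X (nseq (n * k.+1) a)) <->
  tokens_lang X (nseq (if size X %/ n * n == size X then size X else size X * n) a).
Proof.
set m := size X => iX m_gt0 n_gt0; split.
  move=> [k Tk]; have [le_m [e|pump]] := tokens_lang_nseq iX Tk; last first.
    by apply: pump; case: ifP => // _; rewrite leq_pmulr.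
  by rewrite -/m in e; rewrite e in Tk; rewrite (_ : m %/ n * n = m) ?eqxx // -e mulKn // mulnC.
case: eqP => [e|_] Tm.
  by exists (m %/ n).-1; rewrite prednK ?[n * _]mulnC ?e //; move: e m_gt0; case: (_ %/ _) => // <-.
by exists m.-1; rewrite prednK // mulnC.
Qed.

(** Justifies skipping a string shorter than A: every symbol yields at least one letter. *)
Lemma tokens_lang_size s u : positive s -> tokens_lang s u -> size s <= size u.
Proof.
elim: s u => // t s IH u /= /andP[t_gt0 ps] [k [v [fk -> /(IH _ ps)]]].
by rewrite size_cat size_nseq; move: fk; rewrite /fits; lia.
Qed.

(** * Starting the loop, locating the operands, answering *)

Definition matchC parse :=
  (Do (IMove 4 2) ;; Do (IMove 17 0) ;; Do (IMove 18 0) ;;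
   Do (IMove 19 0) ;; Do (IMove 20 0) ;; Do (IMove 21 1)) ;;
  matchLoop parse.

(** [N] bounds the weight of a token of B and [D] the initial measure, so [N * D] bounds every
    counter of B. *)
Lemma ok_matchC w rep parse R X Y N D (g h : store) :
  Yformat w rep parse -> consts w g ->
  repItems h 2 X (g 5) -> rep h (g 9) Y (g 10) -> rep h (g 11) R (g 10) ->
  g 5 < 2 ^ w -> g 10 < 2 ^ w -> all isItem X -> positive Y -> positive R ->
  all (fun t => (tw t <= N) && (tf t <= N)) Y ->
  all (fun t => (tw t <= N) && (tf t <= N)) R ->
  R = [::] \/ [/\ 1 < size R, sorted letter_neq R & sorted letter_neq Y] ->
  size X < 2 ^ w -> N * D < 2 ^ w ->
  (if R is [::] then size X + size Y else 4 * size X + 3) <= D ->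
  ok w (matchC parse) (6 + matchCost parse D) g h (fun g' _ =>
    exists2 b : bool, g' 22 = b
      & ((exists j u, tokens_lang X u /\ tokens_lang (Y ++ flatten (nseq j R)) u) <-> b)).
Proof.
move=> yf cs rX rY rR bX bY iX pY pR NY NR wr ltX ltD leD.
(* Both blocks are empty, so whatever register 16 holds may serve as the initial letter. *)
have [c0 c1 c2 c3 cw] := cs; pose s := St (g 16) 0 0 X 0 0 Y.
have le_m : measure R s <= D.
  apply: leq_trans leD; rewrite /measure; case: (R) => [|r R'] //=.
  by rewrite leq_add2l slack_le3.
apply: ok_seq; apply: (ok_weaken (Q := fun g' h' => [/\ mrel w rep R s g' h' & g' 21 = 1])).
- apply: wp_ok; rewrite /= /upd /= c0 c1 c2; split => //.
  by split => //=; split.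
move=> g1 h1 _ _ [rel run1].
have iv : loop_inv R (size X) N (N * D) s.
  by split => //=; rewrite leq_mul2l le_m orbT.
apply: (ok_weaken (ok_matchLoop yf rel iv run1 ltX ltD)).
  by rewrite /matchCost ltnS leq_mul2l ltnS le_m orbT.
move=> g2 h2 _ _ [b res sp]; exists b => //; apply: (iff_trans _ sp).
split=> -[j [u [Tx Ty]]]; exists j, u; first by split; apply/tokens_lang_tok0.
by split; [move/tokens_lang_tok0: Tx|move/tokens_lang_tok0: Ty].
Qed.

(** The encoding records the number of symbols, which take two or three cells each; the end has to
    be found by a pass. *)
Definition scan cnt :=
  Do (IMove 26 0) ;;
  Until (TEq 26 cnt)
    (Do (ILoad 30 23) ;; Do (IArith Div 30 30 3) ;; Do (IArith Add 23 23 30) ;;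
     Do (IArith Add 23 23 2) ;; Do (IArith Add 26 26 1)).

Lemma ok_scan w cnt s e (g h : store) :
  30 \notin [:: cnt] -> 26 != cnt -> 23 != cnt ->
  consts w g -> g cnt = size s -> size s < 2 ^ w -> e < 2 ^ w -> repItems h (g 23) s e ->
  ok w (scan cnt) (7 * size s + 2) g h (fun g' _ => g' 23 = e).
Proof.
move=> n30 n26 n23 cs gc lts lte rs; have -> : 7 * size s + 2 = 1 + (7 * size s).+1 by lia.
apply: ok_seq.
have [c0 c1 c2 c3 cw] := cs.
pose I phi (g' : store) h' := [/\ h' = h, consts w g', g' cnt = size s &
  exists s', [/\ repItems h (g' 23) s' e, g' 26 + size s' = size s & phi = 7 * size s']].
apply: (ok_weaken (Q := I (7 * size s))); [apply: wp_ok|by []|] => /=.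
  split => //; last by exists s; rewrite /upd /= c0.
  by rewrite /upd eq_sym (negbTE n26).
move=> g1 h1 _ _ Ig; apply: (ok_until Ig) => {Ig g1 h1 c0 c1 c2 c3 cs rs}.
  move=> phi g1 h1 [-> [c0 c1 c2 c3 _] gc1 [s' [rs sz ->]]] /=.
  rewrite gc1; case: s' rs sz => [|t s'] rs sz; first by rewrite addn0 in sz; rewrite sz eqxx.
  move=> _; exists 5; first by rewrite /=; lia.
  have /= [_ h1t _ rs'] := rs; have := repItems_size rs' => le_e.
  apply: (ok_weaken (T := 5) (Q := I (7 * size s')) _ (leqnn 5)); last first.
    by move=> g2 h2 _ _ I2; exists (7 * size s') => //=; lia.
  apply: (@wp_ok w (Seq _ _)); rewrite /= /upd /= h1t c1 c2 c3 mulKn //.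
  split; first by lia.
  split; first by lia.
  split; first by rewrite /= in sz; lia.
  rewrite inE in n30; split => //=; first by rewrite !(eq_sym cnt) (negbTE n30) (negbTE n26) (negbTE n23).
  by exists s'; split => //; [rewrite addn2|rewrite -sz /=; lia].
move=> phi g1 h1 [_ _ gc1 [s' [rs sz _]]] /= /eqP e26.
by move: sz rs; rewrite e26 gc1; case: s' => //= t s'; lia.
Qed.

Definition startC :=
  (Do (IConst 1 1) ;; Do (IConst 2 2) ;; Do (IConst 3 3) ;;
   Do (ILoad 27 1) ;; Do (IMove 23 2)) ;;
  scan 27 ;; Do (IMove 5 23).

Definition endOf s := 2 + size (encodes s).

Lemma ok_startC w s (h : store) :
  seg h 0 (encode (Concat s)) -> all flat s -> endOf s < 2 ^ w -> size s < 2 ^ w -> 4 < 2 ^ w ->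
  ok w startC (7 * size s + 8) (fun=> 0) h (fun g' h' =>
    [/\ h' = h, consts w g', g' 27 = size s, g' 5 = endOf s /\ g' 23 = endOf s
      & repItems h 2 (map tok_of s) (endOf s)]).
Proof.
move=> [_ [hs hseg]] fs lte lts ltw.
have rs := seg_items fs hseg; rewrite -/(endOf s) in rs.
have -> : 7 * size s + 8 = 5 + (7 * size s + 2 + 1) by lia.
pose Q0 (g' h' : store) := [/\ h' = h, consts w g', g' 27 = size s & g' 23 = 2].
apply: ok_seq; apply: (ok_weaken (T := 5) (Q := Q0)) => //.
  apply: (@wp_ok w (Seq _ _)); rewrite /= /upd /= hs.
  by do 3![split; first by lia]; split.
move=> g1 h1 _ _ [-> cs g27 g23]; apply: ok_seq.
rewrite -(size_map tok_of) in g27 lts *.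
apply: (ok_weaken (ok_scan _ _ _ cs g27 lts lte _)) => //; first by rewrite g23.
move=> g2 h2 fr fm e23; have cs2 : consts w g2.
  by case: cs => *; split=> //; rewrite fr.
apply: (@wp_ok w (Do _)); rewrite /= /upd; split => //; first exact: fm.
- by case: cs2 => *; split.
- by rewrite /= fr // -(size_map tok_of s).
Qed.

Definition answer c : program :=
  code 0 c ++ [:: IJumpEq 22 0 (len c).+2; IAnswer true; IAnswer false].

Lemma run_answer w c T T' (g h : store) (X : Prop) :
  ok w c T g h (fun g' _ => exists2 b : bool, g' 22 = b & (X <-> b)) ->
  g 0 = 0 -> 0 \notin writes c -> T.+2 <= T' ->
  exists b : bool, run w (answer c) T' (State 0 g h) = Some b /\ (b = true <-> X).
Proof.
move=> [t [g' [h' [le_t [b res Xb] fr _ r]]]] g0 nw leT.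
exists b; split; last by apply: iff_sym; exact: Xb.
have -> : T' = t + (T' - t) by lia.
have := r [::] [:: IJumpEq 22 0 (len c).+2; IAnswer true; IAnswer false] (T' - t).
rewrite /= add0n -/(answer c) => ->.
have [T2 ->] : exists T2, T' - t = T2.+2 by exists (T' - t - 2); lia.
have at_end i : onth (answer c) (len c + i) = onth [:: IJumpEq 22 0 (len c).+2; IAnswer true; IAnswer false] i.
  by rewrite onth_cat size_code ltnNge leq_addr /= addKn.
have e0 := at_end 0; rewrite addn0 in e0; have e1 := at_end 1; rewrite addn1 in e1.
have e2 := at_end 2; rewrite addn2 in e2.
rewrite (@run_jump w _ _ (TEq 22 0) (len c).+2 _ _ _ e0) /= res fr // g0.
have halt p d : onth (answer c) p = Some (IAnswer d) ->
    run w (answer c) T2.+1 (State p g' h') = Some d by move=> e; rewrite /run /= e.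
by case: b {res Xb} => /=; apply: halt.
Qed.

Definition parseLetters := parseItem 9 12 13 14 ;; Do (IMove 15 1).

Lemma matchCost_letters k : matchCost parseLetters k = 42 * k.+1 + 1.
Proof. by rewrite /matchCost addn1. Qed.

Lemma matchCost_runs k : matchCost parseRun k = 40 * k.+1 + 1.
Proof. by rewrite /matchCost addn1. Qed.

Lemma init_seg w input : all (fun x => x < 2 ^ w) input ->
  seg (memory (init_state w input)) 0 input.
Proof.
move=> bd; apply: seg_nth => i lt_i /=; rewrite add0n modn_small //.
exact: (all_nthP 0 bd).
Qed.

Lemma consts_frame w (g g' : store) c : consts w g ->
  (forall r, r \notin writes c -> g' r = g r) ->
  all (fun r => r \notin writes c) [:: 0; 1; 2; 3] -> consts w g'.
Proof. by move=> [? ? ? ? ?] fr /and5P[? ? ? ? _]; split => //; rewrite fr. Qed.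

Lemma all_tok_le N s : 0 < N -> all (fun t => (tw t <= N) && (tf t <= N)) (map tok_of s).
Proof. by move=> N_gt0; elim: s => //= r s ->; case: r => [c|l|l|[]|r] /=; lia. Qed.

Lemma meets_nil X Y :
  (exists j u, tokens_lang X u /\ tokens_lang (Y ++ flatten (nseq j [::])) u) <-> exists u, tokens_lang X u /\ tokens_lang Y u.
Proof.
have e j : flatten (nseq j ([::] : seq tok)) = [::] by elim: j.
by split=> [[j [u]]|[u]]; rewrite ?e ?cats0; [exists u|exists 0, u; rewrite cats0].
Qed.

(** * The three decision programs *)

Definition concatC :=
  startC ;;
  (Do (IArith Add 23 23 1) ;; Do (ILoad 25 23) ;; Do (IArith Add 23 23 1) ;;
   Do (IMove 9 23)) ;;
  scan 25 ;;
  (Do (IMove 10 23) ;; Do (IMove 11 23)) ;;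
  matchC parseLetters.

Lemma ok_concatC w s1 s2 (h : store) (N := size s1 + size s2) :
  seg h 0 (encode (Concat s1) ++ encode (Concat s2)) -> all flat s1 -> all flat s2 ->
  0 < size s1 -> 0 < size s2 -> 100 * N < 2 ^ w ->
  ok w concatC (200 * N) (fun=> 0) h (fun g' _ => exists2 b : bool, g' 22 = b
    & ((exists u, tokens_lang (map tok_of s1) u /\ tokens_lang (map tok_of s2) u) <-> b)).
Proof.
move=> /seg_cat[h1]; rewrite add0n -[size _]/(endOf s1) => -[_ [hs2 hseg2]] f1 f2 s1_gt0 s2_gt0 ltN.
have sz1 := size_encodes_flat f1; have sz2 := size_encodes_flat f2.
have r2 := seg_items f2 hseg2; set e2 := _ + size (encodes s2) in r2.
have bd1 : endOf s1 < 2 ^ w by rewrite /endOf; lia.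
have bd2 : e2 < 2 ^ w by rewrite /e2 /endOf; lia.
apply: (@ok_weaken _ _ ((7 * size s1 + 8) + (4 + ((7 * size s2 + 2) + (2 + (6 + matchCost parseLetters N))))));
  [|by rewrite matchCost_letters /N; lia|by move=> ? ? _ _; exact].
apply: ok_seq; apply: (ok_weaken (ok_startC h1 f1 bd1 _ _)) => //; try lia.
move=> g1 _ _ _ [-> cs1 g27 [g5 g23] rA]; apply: ok_seq.
pose Q1 (g' h' : store) := [/\ h' = h, consts w g', g' 5 = endOf s1, g' 9 = (endOf s1).+2 /\ g' 23 = (endOf s1).+2 & g' 25 = size s2].
have [c0 c1 c2 c3 cw] := cs1.
apply: (ok_weaken (T := 4) (Q := Q1)) => //.
  apply: (@wp_ok w (Seq _ _)); rewrite /= /upd /= g23 c1 addn1 hs2.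
  move: bd2; rewrite /e2 => bd2; split; first lia; split; first lia.
  by rewrite /Q1 /= addn1; split.
move=> g2 _ _ _ [-> cs2 g2_5 [g2_9 g2_23] g2_25]; apply: ok_seq.
rewrite -(size_map tok_of s2) in g2_25 *.
apply: (ok_weaken (ok_scan _ _ _ cs2 g2_25 _ bd2 _)) => //.
- by rewrite size_map; lia.
- by rewrite g2_23.
move=> g3 h3 fr3 fm3 g3_23; rewrite {}fm3 //; apply: ok_seq.
have cs3 : consts w g3 by apply: (consts_frame cs2 fr3).
pose Q2 (g' h' : store) := [/\ h' = h, consts w g', g' 5 = endOf s1, g' 9 = (endOf s1).+2 & g' 10 = e2 /\ g' 11 = e2].
apply: (ok_weaken (T := 2) (Q := Q2)) => //.
  apply: (@wp_ok w (Seq _ _)); rewrite /= /upd /= g3_23; split => //=.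
  - by case: cs3.
  - by rewrite fr3.
  - by rewrite fr3.
move=> g4 _ _ _ [-> cs4 g4_5 g4_9 [g4_10 g4_11]].
have items := isItem_tok_of.
apply: (ok_weaken (@ok_matchC w repItems parseLetters [::] (map tok_of s1) (map tok_of s2) 1 N g4 h
  _ cs4 _ _ _ _ _ _ _ _ _ _ _ _ _ _)) => //; rewrite ?g4_5 ?g4_9 ?g4_10 ?g4_11 //.
- exact: Yformat_items.
- exact: isItem_positive.
- exact: all_tok_le.
- by left.
- by rewrite size_map; lia.
- by lia.
- by rewrite !size_map.
by move=> g5' h5 _ _ [b res sp]; exists b => //; apply: iff_trans sp; apply: iff_sym; apply: meets_nil.
Qed.

(** Leaves take two cells each, so the end of a string is computed from its length in constant time,
    and skipping a short string is cheap. A bare leaf is a string of length 1 that starts at its own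
    label. *)
Definition openC :=
  Do (ILoad 30 23) ;;
  If (TEq 30 0)
    (Do (IMove 24 23) ;; Do (IMove 25 1))
    (Do (IArith Add 24 23 1) ;; Do (ILoad 25 24) ;; Do (IArith Add 24 24 1)) ;;
  Do (IArith Add 23 24 25) ;; Do (IArith Add 23 23 25).

Lemma size_encodes_leaves s : all is_leaf s -> size (encodes s) = 2 * size s.
Proof.
elim: s => // r s IH /andP[lr /IH]; rewrite /encodes /= -/(encodes s) size_cat.
by case: r lr => //= c _ ->; lia.
Qed.

Lemma wp_openC w r (g h : store) : consts w g -> stringy r -> seg h (g 23) (encode r) ->
  g 23 + size (encode r) < 2 ^ w ->
  wp w openC (fun g' _ => [/\ repItems h (g' 24) (map tok_of (kids r)) (g' 23),
    g' 25 = size (kids r), g' 23 = g 23 + size (encode r) & g 23 <= g' 24]) g h.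
Proof.
move=> [c0 c1 _ _ _]; case: r => //= [c _ [ht [hc _]] lt_e|s sl].
  rewrite /upd /= ht c0 /= c1; split; first by lia.
  split; first by lia.
  by split=> //=; [split; rewrite ?addn0 ?addn1|rewrite -addnA].
have {}sl : all is_leaf s := sl.
move=> [ht [hs hseg]]; rewrite -/(encodes s) (size_encodes_leaves sl) => lt_e.
have rs := seg_items (leaf_flat sl) hseg; rewrite (size_encodes_leaves sl) in rs.
rewrite /upd /= ht c0 /= c1 addn1 hs.
do 4![split; first by lia]; split => //=; try lia.
by rewrite addn1; have -> : (g 23).+2 + size s + size s = (g 23).+2 + 2 * size s by lia.
Qed.

(** * Intersection with a union of strings *)

Definition unionBody :=
  openC ;;
  If (TLt 25 27) Skip
    ((Do (IMove 9 24) ;; Do (IMove 10 23) ;; Do (IMove 11 23)) ;;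
     matchC parseLetters ;; If (TEq 22 0) Skip (Do (IMove 29 22))) ;;
  Do (IArith Add 31 31 1).

Definition unionC :=
  startC ;;
  (Do (IArith Add 23 23 1) ;; Do (ILoad 28 23) ;; Do (IArith Add 23 23 1) ;;
   Do (IMove 31 0) ;; Do (IMove 29 0)) ;;
  Until (TEq 31 28) unionBody ;; Do (IMove 22 29).

Definition meets (X : seq tok) (L : language) := exists u, tokens_lang X u /\ L u.

(** The budget depends on the string alone: a string that is matched is at least as long as A, so
    the measure is at most twice its length. *)
Lemma ok_unionBody w X r (b : bool) N (g h : store) :
  consts w g -> repItems h 2 X (g 5) -> g 5 < 2 ^ w -> all isItem X -> g 27 = size X ->
  size X <= N -> size (kids r) <= N -> 100 * N < 2 ^ w ->
  stringy r -> wf r -> seg h (g 23) (encode r) -> g 23 + size (encode r) < 2 ^ w ->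
  g 29 = b -> g 31 < N ->
  ok w unionBody (200 * size (kids r)) g h (fun g' _ =>
    [/\ g' 31 = (g 31).+1, g' 23 = g 23 + size (encode r)
      & exists b' : bool, g' 29 = b' /\ (b' <-> b \/ meets X (lang r))]).
Proof.
move=> cs rX b5 iX g27 leX leN ltN st wr hseg lt_e g29 lt31.
have kids_gt0 : 0 < size (kids r) by case: r wr {leN st hseg lt_e} => //= s /andP[].
set n := size (kids r) in leN kids_gt0 *.
apply: (@ok_weaken _ _ (9 + ((maxn 0 (3 + (6 + matchCost parseLetters (2 * n) + 3))).+2 + 1)));
  [|by rewrite matchCost_letters; lia|by move=> ? ? _ _; exact].
apply: ok_seq; apply: (ok_weaken (wp_ok (wp_openC cs st hseg lt_e))) => // g1 h1 fr1 fm1.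
rewrite {}fm1 // => -[rY g1_25 g1_23 _].
have cs1 : consts w g1 by apply: (consts_frame cs fr1).
apply: ok_seq.
pose Q2 (g' h' : store) := [/\ g' 1 = 1, g' 31 = g 31, g' 23 = g 23 + size (encode r)
      & exists b' : bool, g' 29 = b' /\ (b' <-> b \/ meets X (lang r))].
apply: (ok_weaken (T := (maxn 0 (3 + (6 + matchCost parseLetters (2 * n) + 3))).+2) (Q := Q2)) => //; last first.
  move=> g2 h2 _ _ [o i p q]; apply: (@ok_weaken _ _ 1 1); [apply: (@wp_ok w (Do _))|by []|by move=> ? ? _ _; exact].
  by rewrite /= /upd /= o i addn1; split; [lia|split].
apply: ok_if => /=; rewrite g1_25 fr1 // g27.
have L u := lang_kids u st; case: ifP => [lt_m|ge_m].
  apply: (wp_ok (c := Skip)); rewrite /= /Q2; split => //; first by case: cs1.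
    by rewrite fr1.
  exists b; split; [by rewrite fr1|split]=> [|[//|[u [TXu /L Tu]]]]; first by left.
  have := tokens_lang_size (isItem_positive iX) TXu.
  by move: Tu; rewrite (tok_of_leaf (stringy_kids st)) tokens_lang_letters => ->; rewrite /letters size_map; lia.
pose Q3 (g' h' : store) := [/\ h' = h, consts w g', forall r, r \notin [:: 9; 10; 11] -> g' r = g1 r &
  [/\ g' 9 = g1 24, g' 10 = g1 23 & g' 11 = g1 23]].
apply: ok_seq; apply: (ok_weaken (T := 3) (Q := Q3)) => //.
  apply: (@wp_ok w (Seq _ _)); rewrite /= /upd /=; split => //; first by case: cs1.
  by move=> x; rewrite /= !inE !negb_or => /and3P[/negbTE-> /negbTE-> /negbTE->].
move=> g2 _ _ _ [-> cs2 fr2 [g2_9 g2_10 g2_11]]; apply: ok_seq.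
have g2_5 : g2 5 = g 5 by rewrite fr2 // fr1.
apply: (ok_weaken (@ok_matchC w repItems parseLetters [::] X (map tok_of (kids r)) 1 (2 * n) g2 h
  _ cs2 _ _ _ _ _ _ _ _ _ _ _ _ _ _)) => //; rewrite ?g2_5 ?g2_9 ?g2_10 ?g2_11 ?g1_23 -?g1_23 //.
- exact: Yformat_items.
- by rewrite g1_23.
- exact: isItem_positive (isItem_tok_of _).
- exact: all_tok_le.
- by left.
- by lia.
- by lia.
- by rewrite size_map -/n; lia.
move=> g3 h3 fr3 _ [b' res sp].
apply: (@ok_weaken _ _ 3 3); [apply: (@wp_ok w (If _ _ _))|by []|by move=> ? ? _ _; exact].
have cs3 : consts w g3 by apply: (consts_frame cs2 fr3).
have {sp} sp : meets X (lang r) <-> b'.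
  apply: iff_trans sp; apply: iff_trans (iff_sym (meets_nil _ _)).
  by split=> -[u [TXu /L Tu]]; exists u.
rewrite /= res (const0 cs3) /Q2 /upd; case: b' {res} sp => sp /=.
  split; [by case: cs3|by rewrite fr3 // fr2 // fr1|by rewrite fr3 // fr2|].
  by exists true; split => //; split=> // _; right; apply/sp.
split; [by case: cs3|by rewrite fr3 // fr2 // fr1|by rewrite fr3 // fr2|].
exists b; split; first by rewrite fr3 // fr2 // fr1.
by split=> [bt|[//|/sp]] //; left.
Qed.

Lemma leaves_stringy r : stringy r -> leaves r = size (kids r).
Proof. by case: r => //= s sl; apply/leaves_flat/leaf_flat. Qed.

Lemma size_encode_stringy r : stringy r -> wf r -> size (encode r) <= 4 * leaves r.
Proof.
move=> st; rewrite (leaves_stringy st); case: r st => //= s sl /andP[s_gt0 _].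
by rewrite -/(encodes s) (size_encodes_leaves sl) /=; lia.
Qed.

Lemma size_encodes_stringy s : all stringy s -> all wf s ->
  size (encodes s) <= 4 * sumn (map leaves s) /\ size s <= sumn (map leaves s).
Proof.
elim: s => // r s IH /andP[st ss] /andP[wr ws]; have [leE leS] := IH ss ws.
have := size_encode_stringy st wr; rewrite /encodes /= -/(encodes s) size_cat.
have : 0 < leaves r by rewrite (leaves_stringy st); case: (r) wr => //= l /andP[].
by lia.
Qed.

Lemma ok_unionC w s1 s2 (h : store) (N := size s1 + sumn (map leaves s2)) :
  seg h 0 (encode (Concat s1) ++ encode (Union s2)) -> all flat s1 ->
  all stringy s2 -> all wf s2 -> 0 < size s1 -> 100 * N < 2 ^ w ->
  ok w unionC (300 * N) (fun=> 0) h (fun g' _ => exists2 b : bool, g' 22 = b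
    & (meets (map tok_of s1) (lang (Union s2)) <-> b)).
Proof.
move=> /seg_cat[h1]; rewrite add0n -[size _]/(endOf s1) => -[_ [hs2 hseg2]] f1 st2 wf2 s1_gt0 ltN.
have sz1 := size_encodes_flat f1; have [sz2 sz2'] := size_encodes_stringy st2 wf2.
have bd1 : endOf s1 < 2 ^ w by rewrite /endOf; lia.
set X := map tok_of s1; pose N2 := sumn (map leaves s2).
(* 200 per leaf for the body; the other 2 pay for the loop test and the jump back, since every
   string has a leaf. *)
apply: (@ok_weaken _ _ ((7 * size s1 + 8) + (5 + ((202 * N2).+1 + 1))));
  [|by rewrite /N /N2; lia|by move=> ? ? _ _; exact].
apply: ok_seq; apply: (ok_weaken (ok_startC h1 f1 bd1 _ _)) => //; try lia.
move=> g1 _ _ _ [-> cs1 g27 [g5 g23] rA]; apply: ok_seq; have [c0 c1 c2 c3 cw] := cs1.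
pose I phi (g' h' : store) := [/\ h' = h, consts w g', g' 5 = endOf s1 /\ g' 27 = size s1,
  g' 28 = size s2 & exists todo, exists b : bool, [/\ seg h (g' 23) (encodes todo) /\ g' 23 + size (encodes todo) <= (endOf s1).+2 + size (encodes s2),
    all stringy todo /\ all wf todo, g' 31 + size todo = size s2 /\ sumn (map leaves todo) <= N2, g' 29 = b /\
    (meets X (lang (Union s2)) <-> b \/ meets X (lang (Union todo))) & 202 * sumn (map leaves todo) <= phi]].
apply: (ok_weaken (T := 5) (Q := I (202 * N2))) => //.
  apply: (@wp_ok w (Seq _ _)); rewrite /= /upd /= g23 c0 c1 addn1 hs2.
  rewrite /endOf in bd1 *; split; first by lia.
  split; first by lia.
  rewrite /I /= addn1; split => //.
  exists s2, false; split => //; split => //.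
  by split=> [?|[]] //; right.
move=> g2 h2 _ _ Ig; apply: ok_seq.
apply: (ok_weaken (ok_until (b := TEq 31 28) (a := unionBody) (Q := fun g' _ => exists2 b : bool, g' 29 = b & (meets X (lang (Union s2)) <-> b)) Ig _ _)) => //.
- move=> phi g3 h3 [-> cs3 [g3_5 g3_27] g3_28 [[|r todo] [b [[hseg le_e] [sts wfs] [sz le_todo] [g3_29 sp] le_phi]]]].
    by rewrite /= g3_28 -sz addn0 eqxx.
  move=> _; have /andP[st sts'] := sts; have /andP[wr wfs'] := wfs.
  move: hseg le_e; rewrite /encodes /= -/(encodes todo) => /seg_cat[hr hseg]; rewrite size_cat => le_e.
  have lr := leaves_stringy st; rewrite /= lr in le_phi le_todo.
  have kids_gt0 : 0 < size (kids r) by case: (r) wr => //= l /andP[].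
  exists (200 * size (kids r)); first by clear -le_phi kids_gt0; lia.
  rewrite /endOf -/(encodes s2) in le_e.
  apply: (ok_weaken (@ok_unionBody w X r b N g3 h cs3 _ _ (isItem_tok_of _) _ _ _ ltN st wr hr _ g3_29 _)) => //;
    rewrite ?g3_5 ?size_map //.
  + by rewrite /N leq_addr.
  + by rewrite /N -/N2; clear -le_todo; lia.
  + by clear -le_e sz1 sz2 s1_gt0 ltN bd1; rewrite /endOf in bd1; rewrite /N in ltN; lia.
  + by clear -sz sz2' s1_gt0; rewrite /N; rewrite /= in sz; lia.
  move=> g4 h4 fr4 fm4 [g4_31 g4_23 [b' [g4_29 sp']]].
  exists (202 * sumn (map leaves todo)); first by clear -le_phi kids_gt0; lia.
  split; [exact: fm4|exact: (consts_frame cs3 fr4)|by rewrite !fr4|by rewrite fr4|].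
  exists todo, b'; split => //.
  + by rewrite g4_23; split => //; clear -le_e; rewrite /endOf; lia.
  + by rewrite g4_31 -sz addSnnS; split => //; clear -le_todo; lia.
  + split => //; apply: (iff_trans sp); rewrite sp' /meets /=.
    split=> [[|[u [TX [Lr|Lt]]]]|[[|[u [TX Lr]]]|[u [TX Lt]]]].
    * by left; left.
    * by left; right; exists u.
    * by right; exists u.
    * by left.
    * by right; exists u; split => //; left.
    * by right; exists u; split => //; right.
- move=> phi g3 h3 [_ _ _ g3_28 [todo [b [_ _ [sz _] [g3_29 sp] _]]]] /= /eqP e31.
  exists b => //; apply: (iff_trans sp).
  have -> : todo = [::] by apply: size0nil; move: sz; rewrite e31 g3_28 => sz; clear -sz; lia.
  by split=> [[//|[u []]]|] //; left.
move=> g3 h3 _ _ [b g3_29 sp].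
apply: (@ok_weaken _ _ 1 1); [apply: (@wp_ok w (Do _))|by []|by move=> ? ? _ _; exact].
by exists b.
Qed.

(** * In-place compression of a string into runs *)

Lemma repItems_ext (h h' : store) p s e : repItems h p s e ->
  (forall a, p <= a < e -> h' a = h a) -> repItems h' p s e.
Proof.
elim: s p => //= t s IH p [it hp hc rs] eh; have le_e := repItems_size rs.
split => //; first by rewrite eh //; lia.
  by rewrite eh //; lia.
by apply: IH => // a lt_a; apply: eh; lia.
Qed.

Lemma repRuns_ext (h h' : store) p s e : repRuns h p s e ->
  (forall a, p <= a < e -> h' a = h a) -> repRuns h' p s e.
Proof.
elim: s p => //= t s IH p [t0 hp hc rs] eh; have le_e := repRuns_size rs.
split => //; first by rewrite eh //; lia.
  by rewrite eh //; lia.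
by apply: IH => // a lt_a; apply: eh; lia.
Qed.

Lemma repRuns_rcons (h : store) p s e t : repRuns h p s e -> tf t = 0 ->
  h e = tc t -> h e.+1 = tw t -> repRuns h p (rcons s t) e.+2.
Proof. by elim: s p => [|t' s IH] p /=; [move=> ->|case=> ? ? ? rs *; split => //; apply: IH]. Qed.

Lemma updE f a v x : upd f a v x = if x == a then v else f x.
Proof. by []. Qed.

Lemma repRuns_flush (h : store) p s e a n : repRuns h p s e ->
  repRuns (upd (upd h e a) e.+1 n) p (rcons s (Tok a n 0)) e.+2.
Proof.
move=> rs; apply: repRuns_rcons => //=.
- by apply: (repRuns_ext rs) => x lt_x; rewrite !updE; do 2![case: eqP => [?|_]; first by lia].
- by rewrite !updE eqxx; case: eqP => //; lia.
- by rewrite updE eqxx.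
Qed.

Definition flushC :=
  Do (IStore 32 33) ;; Do (IArith Add 32 32 1) ;;
  Do (IStore 32 34) ;; Do (IArith Add 32 32 1).

Definition compressBody :=
  Do (IArith Add 30 31 1) ;; Do (ILoad 30 30) ;; Do (IArith Add 31 31 2) ;;
  If (TEq 30 33)
    (Do (IArith Add 34 34 1))
    (flushC ;; Do (IMove 33 30) ;; Do (IMove 34 1)).

(** A run takes two cells, like a letter, so the writing position never overtakes the reading
    position and the string can be overwritten by its runs. *)
Definition compressC :=
  (Do (IMove 31 24) ;; Do (IMove 32 24) ;; Do (IArith Add 33 24 1) ;;
   Do (ILoad 33 33) ;; Do (IMove 34 0)) ;;
  Until (TEq 31 23) compressBody ;; flushC.

Lemma ok_compressC w c T (g h : store) :
  consts w g -> repItems h (g 24) [seq Tok x 1 0 | x <- c :: T] (g 23) ->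
  g 23 + 2 < 2 ^ w -> (size T).+1 < 2 ^ w ->
  ok w compressC (13 * (size T).+1 + 10) g h (fun g' h' =>
    repRuns h' (g 24) (runs c 1 T) (g' 32) /\ forall a, a < g 24 -> h' a = h a).
Proof.
move=> cs rs lt_e lt_n; have [c0 c1 c2 c3 cw] := cs.
have le_e := repItems_size rs; rewrite /= size_map in le_e.
have -> : 13 * (size T).+1 + 10 = 5 + ((13 * (size T).+1).+1 + 4) by lia.
pose I phi (g' h' : store) := exists done T', [/\ consts w g', repItems h' (g' 31) [seq Tok x 1 0 | x <- T'] (g' 23) /\ g' 23 = g 23,
  repRuns h' (g 24) done (g' 32) /\ g' 32 <= g' 31, done ++ runs (g' 33) (g' 34) T' = runs c 1 T &
  [/\ g' 34 + size T' <= (size T).+1, forall a, a < g 24 -> h' a = h a & phi = 13 * size T']].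
apply: ok_seq; apply: (ok_weaken (T := 5) (Q := I (13 * (size T).+1))) => //.
  have [_ _ hc _] := rs.
  apply: (@wp_ok w (Seq _ _)); rewrite /= /upd /= c0 c1 addn1; split; first by lia.
  (* The count starts at 0 with the first letter still unread: [runs c 0 (c :: T)] is
     [runs c 1 T]. *)
  exists [::], (c :: T); split => //=; rewrite /=.
  by rewrite -(addn0 (g 24)) hc eqxx.
move=> g1 h1 _ _ Ig; apply: ok_seq.
pose Q1 (g' h' : store) := exists done, [/\ consts w g', repRuns h' (g 24) done (g' 32),
  g' 32 <= g 23, done ++ [:: Tok (g' 33) (g' 34) 0] = runs c 1 T & forall a, a < g 24 -> h' a = h a].
apply: (ok_weaken (ok_until (b := TEq 31 23) (a := compressBody) (Q := Q1) Ig _ _)) => //.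
- move=> phi g2 h2 [dn [[|x T'] [[z0 z1 z2 z3 _] [ri g23] [rr le_w] er [lec fr ->]]]].
    by rewrite /= in ri; rewrite /= ri eqxx.
  move=> _; exists 11; first by rewrite /=; lia.
  have [_ _ hx ri'] := ri; rewrite !addn0 /= in hx ri'.
  have le2 := repItems_size ri'; rewrite size_map in le2.
  apply: (ok_weaken (T := 11) (Q := I (13 * size T'))) => //; last first.
    by move=> g3 h3 _ _ I3; exists (13 * size T') => //=; lia.
  apply: (@wp_ok w (Seq _ _)); rewrite /= in er lec.
  rewrite /= !updE /= z1 addn1 hx z2; split; first by lia.
  split; first by lia.
  case: (x =P g2 33) er => [ex|nx] er.
    split; first by lia.
    exists dn, T'; split => //=; rewrite /upd /=.
    + by rewrite addn2.
    + by split => //; lia.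
    + by rewrite addn1.
    + by split => //; lia.
  rewrite ?updE /= ?z1; split; first by lia.
  split; first by lia.
  (* The current letter was loaded before the flush, whose two cells lie below the new reading
     position. *)
  rewrite addn1; set h' := upd (upd h2 _ _) _ _.
  have eh a : a <> g2 32 -> a <> (g2 32).+1 -> h' a = h2 a.
    by move=> n1 n2; rewrite /h' !updE; do 2![case: eqP => // _].
  exists (rcons dn (Tok (g2 33) (g2 34) 0)), T'; split => //=.
  + split => //; rewrite !updE /= addn2.
    by apply: (repItems_ext ri') => a lt_a; apply: eh; lia.
  + by rewrite !updE /= addn1 addn2; split; [apply: repRuns_flush|lia].
  + by rewrite !updE /= ?z1 cat_rcons.
  + split => //; first by rewrite !updE /= ?z1; lia.
    have := repRuns_size rr => le_r a lt_a; rewrite eh ?fr //; lia.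
- move=> phi g2 h2 [dn [T' [cs2 [ri g23] [rr le_w] er [_ fr _]]]] /= /eqP e31.
  exists dn; split => //; first by rewrite -g23 -e31.
  by case: T' ri er => //= x T' [_ _ _ /repItems_size]; rewrite e31; lia.
move=> g2 h2 _ _ [dn [[z0 z1 z2 z3 _] rr le_w er fr]].
apply: (wp_ok (c := flushC)); rewrite /= !updE /= ?z1 addn1; split; first by lia.
split; first by lia.
rewrite ?updE /= ?addn1 -er cats1; split; first exact: repRuns_flush.
have := repRuns_size rr => le_r a lt_a; rewrite !updE.
by do 2![case: eqP => [?|_]; first by lia]; exact: fr.
Qed.

(* If [a ^ K] is in [L(A)] then [K = m], or [L(A)] contains [a ^ K'] for all
   [K' >= m]: for [T = a ^ n] it suffices to test one multiple of [n]. *)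
Definition multipleC :=
  Do (IArith Div 30 27 25) ;; Do (IArith Mul 30 30 25) ;;
  If (TEq 30 27) Skip (Do (IArith Mul 30 27 25)).

Definition multiple m n := if m %/ n * n == m then m else m * n.

Lemma wp_multipleC w m n (g h : store) Q : g 27 = m -> g 25 = n ->
  m < 2 ^ w -> m * n < 2 ^ w ->
  (forall g', g' =1 upd g 30 (multiple m n) -> Q g' h) -> wp w multipleC Q g h.
Proof.
move=> gm gn lt_m lt_mn q; rewrite /= /upd /= gm gn; split.
  by apply: leq_ltn_trans (leq_trunc_div _ _) _.
rewrite /multiple in q; case: eqP q => [e|_] q; last split => //;
  by apply: q => x; rewrite /upd; case: (x == 30).
Qed.

(** The length of the chosen power replaces the weight of the only run, and making the start equal
    to the end switches wrapping off. *)
Definition unaryC :=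
  multipleC ;; Do (IArith Add 31 24 1) ;; Do (IStore 31 30) ;; Do (IMove 11 10).

(** The runs end two cells after their start exactly when there is only one. *)
Definition finishC :=
  (Do (IMove 9 24) ;; Do (IMove 10 32) ;; Do (IMove 11 24) ;;
   Do (IArith Add 30 24 2)) ;;
  If (TEq 30 32) unaryC Skip.

Definition plusC :=
  startC ;;
  (Do (IArith Add 23 23 1) ;; openC) ;;
  compressC ;;
  finishC ;; matchC parseRun.

Lemma lang_plus_kids r u : stringy r ->
  lang (Plus r) u <-> exists k, u = flatten (nseq k.+1 (letters (kids r))).
Proof.
move=> st; have pw k := @lang_pow_word k (lang r) (letters (kids r)) u.
have L v : lang r v <-> v = letters (kids r).
  by rewrite (lang_kids v st) (tok_of_leaf (stringy_kids st)) tokens_lang_letters.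
split=> [[[//|k] _ /pw-/(_ L)]|[k /pw-/(_ L)]]; first by exists k.
by exists k.+1.
Qed.

Lemma size_runs_le a n T : size (runs a n T) <= (size T).+1.
Proof. by elim: T a n => //= c T IH a n; case: ifP => _ /=; [apply: leqW|rewrite ltnS]; apply: IH. Qed.

Lemma size_runs_gt0 a n T : 0 < size (runs a n T).
Proof. by have [m [s ->]] := runs_head a n T. Qed.

Lemma ok_finishC w X c T (g h : store) (N := size X + (size T).+1) (e := g 5) :
  consts w g -> repItems h 2 X e -> e <= g 24 -> e < 2 ^ w -> all isItem X -> 0 < size X ->
  g 27 = size X -> g 25 = (size T).+1 -> repRuns h (g 24) (runs c 1 T) (g 32) ->
  g 32 + 2 < 2 ^ w -> 100 * (N * N * N) < 2 ^ w ->
  ok w (Seq finishC (matchC parseRun)) (200 * N) g h (fun g' _ => exists2 b : bool, g' 22 = b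
    & ((exists k, tokens_lang X (flatten (nseq k.+1 (c :: T)))) <-> b)).
Proof.
move=> cs rA le_e lt_e iX X_gt0 g27 g25 rr lt32 ltN; have [c0 c1 c2 c3 cw] := cs.
set n := (size T).+1 in N ltN g25 *; set m := size X in N ltN g27 X_gt0 *.
have sz := repRuns_size rr; have sz_gt0 := size_runs_gt0 c 1 T.
have mn : m * n <= N * N by rewrite leq_mul // /N ?leq_addr ?leq_addl.
have N_gt0 : 0 < N by rewrite /N; lia.
have leD : 4 * m + 3 <= 7 * N by clear -X_gt0; rewrite /N; lia.
(* This is where the cube is spent: a weight of up to [m * n] times a measure of up to
   [4 * m + 3]. *)
have ltD : m * n * (4 * m + 3) < 2 ^ w.
  apply: leq_ltn_trans (leq_mul mn leD) _; rewrite mulnCA.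
  by apply: leq_ltn_trans ltN; rewrite leq_mul2r; apply/orP; right.
have lt_mn : m * n < 2 ^ w by apply: leq_ltn_trans ltD; rewrite leq_pmulr // addn_gt0 orbT.
have lt_m : m < 2 ^ w by apply: leq_ltn_trans lt_mn; rewrite leq_pmulr.
have ltnD : n * (4 * m + 3) < 2 ^ w.
  by apply: leq_ltn_trans ltD; rewrite leq_mul2r leq_pmull ?orbT.
clear mn ltN.
apply: (@ok_weaken _ _ (14 + (6 + matchCost parseRun (4 * m + 3))));
  [|by rewrite matchCost_runs; clear -X_gt0; rewrite /N; lia|by move=> ? ? _ _; exact].
apply: ok_seq.
have [un|nun] := eqVneq (size (runs c 1 T)) 1.
  have [T_c runs_c] := runs_unary un; rewrite add1n -/n in runs_c.
  pose v := multiple m n.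
  have le_v : v <= m * n by rewrite /v /multiple; case: eqP => // _; rewrite leq_pmulr.
  have v_gt0 : 0 < v by rewrite /v /multiple; case: eqP => // _; rewrite muln_gt0 X_gt0.
  pose Q (g' h' : store) := [/\ consts w g', g' 5 = e, repItems h' 2 X e,
    repRuns h' (g' 9) [:: Tok c v 0] (g' 10) & g' 11 = g' 10 /\ g' 10 = g 32].
  have e32 : g 24 + 2 = g 32 by rewrite -sz un.
  have lt_e32 : g 32 < 2 ^ w by clear -lt32; lia.
  have lt24 : (g 24).+1 < 2 ^ w by clear -lt32 e32; lia.
  apply: (ok_weaken (T := 14) (Q := Q)) => //.
    apply: (@wp_ok w finishC).
    rewrite runs_c in rr; have [_ hc _ _] := rr.
    rewrite wp_seq; set k := wp w (If _ _ _) _.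
    rewrite /= /upd /= c2 e32; split=> //.
    rewrite {}/k; apply: wp_if_true; first by rewrite /=.
    rewrite wp_seq; apply: (wp_multipleC (m := m) (n := n)) => // g1 e1.
    rewrite /= /upd /= !e1 /upd /= c1 addn1; split => //.
    split => //=; rewrite ?e1 //.
    - by split; rewrite /= ?e1.
    - by apply: (repItems_ext rA) => a lt_a; case: eqP => //; clear -lt_a le_e; lia.
    - rewrite /upd /= eqxx; split => //; last by rewrite -e32 addn2.
      by case: eqP => //; clear; lia.
  move=> g1 h1 _ _ [cs1 g1_5 rA1 rY1 [g1_11 g1_10]].
  have le1 : 1 <= m * n by rewrite muln_gt0 X_gt0.
  apply: (ok_weaken (@ok_matchC w repRuns parseRun [::] X [:: Tok c v 0] (m * n) (4 * m + 3) g1 h1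
    (@Yformat_runs w) cs1 _ rY1 _ _ _ iX _ _ _ _ _ lt_m ltD _)) => //; rewrite ?g1_5 ?g1_10 //.
  - by rewrite /= v_gt0.
  - by rewrite /= le_v.

  - by left.
  - by clear; rewrite /m /=; lia.
  move=> g2 h2 _ _ [b res sp]; exists b => //; apply: iff_trans sp; apply: iff_trans (iff_sym (meets_nil X [:: Tok c v 0])).
  apply: (iff_trans (B := exists k, tokens_lang X (nseq (n * k.+1) c))).
    have pw k : flatten (nseq k (c :: T)) = nseq (n * k) c.
      have -> : c :: T = nseq n c by rewrite /= -T_c.
      by elim: k => [|k IH]; rewrite ?muln0 // mulnS nseqD -IH.
    by split=> -[k Tk]; exists k; [rewrite -pw|rewrite pw].
  apply: (iff_trans (tokens_lang_nseq_multiple c iX X_gt0 _)) => //; rewrite -/m -/(multiple m n) -/v.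
  split=> [Tv|[u [TXu [k [u' [fk eu eu0]]]]]].
    exists (nseq v c); split => //; exists v, [::].
    by rewrite cats0; split => //; rewrite /fits eqxx.
  by move: fk TXu; rewrite /fits orbF => /eqP ek; rewrite eu eu0 cats0 ek.
pose Q (g' h' : store) := [/\ h' = h, consts w g', g' 5 = e & [/\ g' 9 = g 24, g' 10 = g 32 & g' 11 = g 24]].
have ne32 : (g 24 + 2 == g 32) = false.
  by apply/eqP => e32; case/eqP: nun; move: sz; rewrite -e32; clear; lia.
apply: (ok_weaken (T := 14) (Q := Q)) => //.
  apply: (@wp_ok w finishC); rewrite wp_seq; set k := wp w (If _ _ _) _.
  rewrite /= /upd /= c2; split; first by move: sz lt32; clear -sz_gt0; lia.
  rewrite {}/k; apply: wp_if_false; first by rewrite /= ne32.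
  by split => //; split.
move=> g1 _ _ _ [-> cs1 g1_5 [g1_9 g1_10 g1_11]].
apply: (ok_weaken (@ok_matchC w repRuns parseRun (runs c 1 T) X (runs c 1 T) n (4 * m + 3) g1 h
    (@Yformat_runs w) cs1 _ _ _ _ _ iX _ _ _ _ _ lt_m ltnD _)) => //; rewrite ?g1_5 ?g1_9 ?g1_10 ?g1_11 //.
- by clear -lt32; lia.
- exact: runs_positive.
- exact: runs_positive.
- by apply: runs_weight.
- by apply: runs_weight.
- right; split; try exact: runs_sorted.
  by rewrite ltn_neqAle eq_sym nun.
- by case: (runs c 1 T) sz_gt0.
move=> g2 h2 _ _ [b res sp]; exists b => //; apply: iff_trans sp.
(* The first copy is the initial content of B and the wraps supply the other [k]. *)
have pw k u : tokens_lang (runs c 1 T ++ flatten (nseq k (runs c 1 T))) u <-> u = flatten (nseq k.+1 (c :: T)).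
  exact: (tokens_lang_runs_rep c 1 T k.+1 u).
split=> [[k Tk]|[k [u [TXu /pw eu]]]]; last by exists k; rewrite -eu.
by exists k, (flatten (nseq k.+1 (c :: T))); split => //; apply/pw.
Qed.

Lemma ok_plusC w s1 r (h : store) (N := size s1 + size (kids r)) :
  seg h 0 (encode (Concat s1) ++ encode (Plus r)) -> all flat s1 -> 0 < size s1 ->
  stringy r -> wf r -> 100 * (N * N * N) < 2 ^ w ->
  ok w plusC (300 * N) (fun=> 0) h (fun g' _ => exists2 b : bool, g' 22 = b
    & (meets (map tok_of s1) (lang (Plus r)) <-> b)).
Proof.
move=> /seg_cat[h1]; rewrite add0n -[size _]/(endOf s1) => -[_ hr] f1 s1_gt0 st wr ltN.
have sz1 := size_encodes_flat f1; have szr := size_encode_stringy st wr.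
rewrite (leaves_stringy st) in szr.
have kids_gt0 : 0 < size (kids r) by case: (r) wr => //= l /andP[].
have ltN1 : 100 * N < 2 ^ w.
  apply: leq_ltn_trans ltN; rewrite leq_mul2l /= -mulnA leq_pmulr // muln_gt0.
  by rewrite /N addn_gt0 s1_gt0.
have bd1 : endOf s1 < 2 ^ w by clear -sz1 ltN1 s1_gt0; rewrite /endOf; rewrite /N in ltN1; lia.
have bd2 : (endOf s1).+1 + size (encode r) + 2 < 2 ^ w.
  by clear -sz1 szr ltN1 s1_gt0 kids_gt0; rewrite /endOf; rewrite /N in ltN1; lia.
have lt_s1 : size s1 < 2 ^ w by clear -ltN1; rewrite /N in ltN1; lia.
have lt_kids : size (kids r) < 2 ^ w by clear -ltN1; rewrite /N in ltN1; lia.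
have lt4 : 4 < 2 ^ w by clear -ltN1 s1_gt0; rewrite /N in ltN1; lia.
apply: (@ok_weaken _ _ ((7 * size s1 + 8) + ((1 + 9) + ((13 * size (kids r) + 10) + 200 * N))));
  [|by clear -s1_gt0; rewrite /N; lia|by move=> ? ? _ _; exact].
clear ltN1; apply: ok_seq; apply: (ok_weaken (ok_startC h1 f1 bd1 lt_s1 lt4)) => //.
move=> g1 _ _ _ [-> cs1 g27 [g5 g23] rA]; have [c0 c1 c2 c3 cw] := cs1.
apply: ok_seq; apply: ok_seq.
pose Q1 (g' h' : store) := [/\ h' = h, consts w g', g' 27 = size s1, g' 5 = endOf s1 & g' 23 = (endOf s1).+1].
apply: (ok_weaken (T := 1) (Q := Q1)) => //.
  apply: (@wp_ok w (Do _)); rewrite /= /upd /= g23 c1 addn1; split => //.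
  by clear -bd2; lia.
move=> g2 _ _ _ [-> cs2 g2_27 g2_5 g2_23].
have lt_open : g2 23 + size (encode r) < 2 ^ w by rewrite g2_23; clear -bd2; lia.
have seg_open : seg h (g2 23) (encode r) by rewrite g2_23.
apply: (ok_weaken (wp_ok (wp_openC cs2 st seg_open lt_open))) => // g3 h3 fr3 fm3.
rewrite {}fm3 // => -[rY g3_25 g3_23 le24]; rewrite g2_23 in g3_23 le24.
have cs3 : consts w g3 by apply: (consts_frame cs2 fr3).
rewrite (tok_of_leaf (stringy_kids st)) in rY.
have szl : size (kids r) = size (letters (kids r)) by rewrite size_map.
have lp u := lang_plus_kids u st.
rewrite /N szl in ltN *; rewrite szl in g3_25 lt_kids kids_gt0; clear N szl szr.
case: (letters (kids r)) rY g3_25 lt_kids kids_gt0 ltN lp => // c T rY g3_25 lt_kids _ ltN lp.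
apply: ok_seq; apply: (ok_weaken (ok_compressC cs3 rY _ lt_kids)) => //; first by rewrite g3_23.
move=> g4 h4 fr4 _ [rr fr]; have cs4 : consts w g4 by apply: (consts_frame cs3 fr4).
have g4_5 : g4 5 = endOf s1 by rewrite fr4 // fr3.
have g4_24 : g4 24 = g3 24 by rewrite fr4.
rewrite -(size_map tok_of s1) in g2_27 s1_gt0 ltN *; rewrite -g4_24 in rr.
apply: (ok_weaken (@ok_finishC w (map tok_of s1) c T g4 h4 cs4 _ _ _ (isItem_tok_of _) s1_gt0 _ _ rr _ ltN)) => //.
(* Compression leaves every cell before the string intact, hence all of A. *)
- rewrite g4_5; apply: (repItems_ext rA) => a /andP[_ lt_a]; apply: fr.
  exact: ltn_trans lt_a le24.
- by rewrite g4_5 g4_24 ltnW.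
- by rewrite g4_5.
- by rewrite fr4 // fr3.
- by rewrite fr4.
- have := repRuns_size rr; have := repItems_size rY; have := size_runs_le c 1 T.
  by rewrite /= size_map g4_24 g3_23 => leR leE eR; clear -leR leE eR bd2; lia.
move=> g6 h5 _ _ [b res sp]; exists b => //; apply: iff_trans sp.
split=> [[u [TXu /lp[k eu]]]|[k Tk]]; first by exists k; rewrite -eu.
by exists (flatten (nseq k.+1 (c :: T))); split => //; apply/lp; exists k.
Qed.

(** * Shapes of the inputs, word size, and assembly of the three cases *)

Lemma homogeneous_concat_plus A : wf A -> homogeneous (LConcat, LPlus) A ->
  exists2 s, A = Concat s & (0 < size s) && all flat s.
Proof. by case: A => // s /andP[s_gt0 _] /andP[_ fs]; exists s; rewrite ?s_gt0. Qed.

Lemma encode_stringy_bounded sigma W r : stringy r -> over_alphabet sigma r -> sigma <= W ->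
  3 < W -> leaves r < W -> all (fun x => x < W) (encode r).
Proof.
case: r => //= [c _ lt_c leW W3 _|s sl os leW W3 lt_s].
  by rewrite andbT; apply/andP; split; [lia|apply: leq_trans leW].
have {}sl : all is_leaf s := sl; have fs := leaf_flat sl.
rewrite (leaves_flat fs) in lt_s; rewrite lt_s (encodes_bounded fs os leW W3) andbT.
by clear -W3; lia.
Qed.

Lemma encodes_stringy_bounded sigma W s : all stringy s -> all (over_alphabet sigma) s ->
  sigma <= W -> 3 < W -> sumn (map leaves s) < W -> all (fun x => x < W) (encodes s).
Proof.
move=> st os leW W3; elim: s st os => // r s IH /andP[st ss] /andP[o os] /= lt_s.
rewrite /encodes /= -/(encodes s) all_cat (encode_stringy_bounded st o leW W3) ?IH //.
  by clear -lt_s; lia.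
by clear -lt_s; lia.
Qed.

Lemma encode_flat_bounded sigma W s : all flat s -> all (over_alphabet sigma) s ->
  sigma <= W -> 3 < W -> size s < W -> all (fun x => x < W) (encode (Concat s)).
Proof.
move=> fs os leW W3 lt_s; rewrite /= lt_s (encodes_bounded fs os leW W3) andbT.
by clear -W3; lia.
Qed.

(** Origin of the exponent: as [N] is at least 2, the factor 100 is below N^7, and the cube takes
    three more powers. *)
Lemma word_size_bounds N sigma d w : 1 < N -> sigma <= N ^ d -> N ^ (d + 10) <= 2 ^ w ->
  sigma <= 2 ^ w /\ 100 * (N * N * N) < 2 ^ w.
Proof.
move=> N_gt1 le_s le_w; have N_gt0 : 0 < N by exact: ltnW.
split; first by apply: leq_trans le_s (leq_trans _ le_w); rewrite leq_pexp2l // leq_addr.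
apply: leq_trans le_w; apply: (@leq_trans (N ^ 10)); last by rewrite leq_pexp2l // leq_addl.
rewrite (expnD N 7 3) (_ : N * N * N = N ^ 3); last by rewrite -mulnA.
apply: (@leq_trans (2 ^ 7 * N ^ 3)); last by rewrite leq_mul2r leq_exp2r // N_gt1 orbT.
by rewrite ltn_mul2r expn_gt0 N_gt0.
Qed.

Lemma hits_lang s L : all flat s ->
  meets (map tok_of s) L <-> exists u, lang (Concat s) u /\ L u.
Proof. by move=> fs; split=> -[u [Lu ?]]; exists u; split => //; apply/(lang_items u fs). Qed.

Lemma homogeneous_union_concat B : wf B -> homogeneous (LUnion, LConcat) B ->
  exists2 s, B = Union s & [/\ 0 < size s, all stringy s & all wf s].
Proof. by case: B => // s /andP[s_gt0 ws] /andP[_ st]; exists s. Qed.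

Lemma homogeneous_plus_concat B : wf B -> homogeneous (LPlus, LConcat) B ->
  exists2 r, B = Plus r & stringy r /\ wf r.
Proof. by case: B => // r wr /andP[_ /andP[st _]]; exists r. Qed.

(** The initial memory holds the input modulo the word size; with this bound it holds the encoding
    itself. *)
Lemma encode_bounded t sigma W B :
  t = (LConcat, LPlus) \/ t = (LUnion, LConcat) \/ t = (LPlus, LConcat) ->
  wf B -> homogeneous t B -> over_alphabet sigma B ->
  sigma <= W -> 3 < W -> leaves B < W -> all (fun x => x < W) (encode B).
Proof.
case=> [|[|]] -> wB hB.
- have [s -> /andP[_ fs]] := homogeneous_concat_plus wB hB => /= os leW W3.
  by rewrite (leaves_flat fs); exact: encode_flat_bounded fs os leW W3.
- have [s -> [_ st ws]] := homogeneous_union_concat wB hB => os leW W3 /= lt_s.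
  rewrite (encodes_stringy_bounded st os leW W3 lt_s) andbT.
  have [_ le_s] := size_encodes_stringy st ws; rewrite (leq_ltn_trans le_s lt_s) andbT.
  by clear -W3; lia.
have [r -> [st wr]] := homogeneous_plus_concat wB hB => o leW W3 lt_r.
by rewrite /= W3 (encode_stringy_bounded st o leW W3 lt_r).
Qed.

(** Makes the total size at least 2, so that its powers grow and [word_size_bounds] applies. *)
Lemma leaves_gt0 t B :
  t = (LConcat, LPlus) \/ t = (LUnion, LConcat) \/ t = (LPlus, LConcat) ->
  wf B -> homogeneous t B -> 0 < leaves B.
Proof.
case=> [|[|]] -> wB hB.
- by have [s -> /andP[s_gt0 fs]] := homogeneous_concat_plus wB hB; rewrite /= leaves_flat.
- have [s -> [s_gt0 st ws]] := homogeneous_union_concat wB hB.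
  by apply: leq_trans (size_encodes_stringy st ws).2.
have [r -> [st wr]] := homogeneous_plus_concat wB hB; rewrite /= leaves_stringy //.
by case: (r) wr => //= s /andP[].
Qed.

Definition solves t c := forall w s B (h : store) (N := size s + leaves B),
  all flat s -> 0 < size s -> wf B -> homogeneous t B -> 100 * (N * N * N) < 2 ^ w ->
  seg h 0 (encode (Concat s) ++ encode B) ->
  ok w c (300 * N) (fun=> 0) h (fun g' _ => exists2 b : bool, g' 22 = b
    & (meets (map tok_of s) (lang B) <-> b)).

Lemma cube_bound N w : 0 < N -> 100 * (N * N * N) < 2 ^ w -> 100 * N < 2 ^ w.
Proof.
move=> N_gt0; apply: leq_ltn_trans.
by rewrite leq_mul2l /= -mulnA leq_pmulr // muln_gt0 N_gt0.
Qed.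

Lemma solves_concatC : solves (LConcat, LPlus) concatC.
Proof.
move=> w s B h N fs s_gt0 wB hB ltN hseg.
have N_gt0 : 0 < N by rewrite /N addn_gt0 s_gt0.
have [s2 eB /andP[s2_gt0 fs2]] := homogeneous_concat_plus wB hB.
have eN : N = size s + size s2 by rewrite /N eB /= leaves_flat.
have := cube_bound N_gt0 ltN; rewrite eB in hseg *; rewrite eN => ltN1.
apply: (ok_weaken (ok_concatC hseg fs fs2 s_gt0 s2_gt0 ltN1)); first by rewrite leq_mul2r orbT.
move=> g' h' _ _ [b res sp]; exists b => //; apply: iff_trans sp.
by split=> -[u [Tu Lu]]; exists u; split => //; apply/(lang_items u fs2).
Qed.

Lemma solves_unionC : solves (LUnion, LConcat) unionC.
Proof.
move=> w s B h N fs s_gt0 wB hB ltN hseg.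
have N_gt0 : 0 < N by rewrite /N addn_gt0 s_gt0.
have := cube_bound N_gt0 ltN; rewrite /N => {N N_gt0 ltN}.
have [s2 eB [s2_gt0 st2 ws2]] := homogeneous_union_concat wB hB; subst B => ltN.
exact: (ok_unionC hseg fs st2 ws2 s_gt0 ltN).
Qed.

Lemma solves_plusC : solves (LPlus, LConcat) plusC.
Proof.
move=> w s B h N fs s_gt0 wB hB; rewrite /N => {N}.
have [r -> [st wr]] := homogeneous_plus_concat wB hB; rewrite /= leaves_stringy // => ltN hseg.
exact: (ok_plusC hseg fs s_gt0 st wr ltN).
Qed.

Theorem theorem3 (t : label * label)
    (ht : t = (LConcat, LPlus) \/ t = (LUnion, LConcat) \/ t = (LPlus, LConcat))
    (d : nat) :
  exists (P : program) (C k : nat),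
    forall (m n sigma w : nat) (A B : regexp),
      wf A -> homogeneous (LConcat, LPlus) A -> leaves A = m ->
      wf B -> homogeneous t B -> leaves B = n ->
      over_alphabet sigma A -> over_alphabet sigma B ->
      sigma <= (m + n) ^ d ->
      (m + n) ^ k <= 2 ^ w ->
      exists b : bool,
        run w P (C * (m + n)) (init_state w (encode A ++ encode B)) = Some b /\
        (b = true <-> exists u : seq nat, lang A u /\ lang B u).
Proof.
have [c [c0 sol]] : exists c, 0 \notin writes c /\ solves t c.
  case: ht => [|[|]] ->; [exists concatC|exists unionC|exists plusC]; split=> //.
  - exact: solves_concatC.
  - exact: solves_unionC.
  - exact: solves_plusC.
(* 300 per leaf for the command; one more per leaf covers the two answering steps, since there are
   at least two leaves. *)
exists (answer c), 301, (d + 10) => m n sigma w A B wA hA lA wB hB lB oA oB le_s le_w.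
have [s eA /andP[s_gt0 fs]] := homogeneous_concat_plus wA hA.
have lA' : size s = m by rewrite -lA eA /= leaves_flat.
have n_gt0 : 0 < n by rewrite -lB (leaves_gt0 ht wB hB).
have N_gt1 : 1 < m + n by rewrite -lA'; clear -s_gt0 n_gt0; lia.
have [le_sw ltN] := word_size_bounds N_gt1 le_s le_w.
have lt1 := cube_bound (ltnW N_gt1) ltN.
have W3 : 3 < 2 ^ w by clear -lt1 N_gt1; lia.
have seg0 : seg (memory (init_state w (encode A ++ encode B))) 0 (encode A ++ encode B).
  apply: init_seg; rewrite all_cat (encode_bounded (or_introl erefl) wA hA oA le_sw W3).
    rewrite (encode_bounded ht wB hB oB le_sw W3) //.
    by rewrite lB; clear -lt1; lia.
  by rewrite lA; clear -lt1; lia.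
rewrite eA -lB -lA' in seg0 ltN *.
have okc := sol _ _ _ _ fs s_gt0 wB hB ltN seg0.
have [|b [rn sp]] := run_answer (T' := 301 * (size s + leaves B)) okc erefl c0.
  by rewrite lA' lB; clear -N_gt1; lia.
by exists b; split => //; apply: (iff_trans sp); apply: hits_lang.
Qed.
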